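(* Let $\Gamma$ be a finite abelian group of odd order $n\ge 3$, let $S$ be a generating set of $\Gamma$ with $S=-S$ and $0\notin S$, and let $G=\operatorname{Cay}(\Gamma,S)$. Then $G$ is Hamiltonian-transitive if and only if $G$ is isomorphic to the complete graph $K_n$ or to the cycle $C_n$.
   Context: All graphs are finite, simple and undirected; groups are finite and written additively. $\operatorname{Cay}(\Gamma,S)$ has vertex set $\Gamma$, with $x,y$ adjacent iff $x-y\in S$. A Hamiltonian cycle is a cycle (of length at least 3) through all vertices, identified with its edge set. A graph is Hamiltonian-transitive if it has a Hamiltonian cycle and for every pair of Hamiltonian cycles there is an automorphism of the graph mapping one to the other. $K_n$ and $C_n$ denote the complete graph and the cycle on $n$ vertices. *)

(* Defs.v *)
From HB Require Import structures.
From mathcomp Require Import all_boot all_order all_fingroup all_algebra.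

Set Implicit Arguments.
Unset Strict Implicit.
Unset Printing Implicit Defensive.

Import GRing.Theory.

(* A simple graph on the finite vertex type T is given by its adjacency
   relation e : rel T, meant to be symmetric and irreflexive; this is proved
   below for the three families of graphs used here. *)

Definition graph_iso (T1 T2 : finType) (e1 : rel T1) (e2 : rel T2) : Prop :=
  exists2 f : T1 -> T2, bijective f & forall x y, e2 (f x) (f y) = e1 x y.

Definition graph_aut (T : finType) (e : rel T) (f : {perm T}) : Prop :=
  forall x y, e (f x) (f y) = e x y.

(* An edge is the two-element set of its end points; next c x is the cyclic
   successor of x in c. *)
Definition cycle_edges (T : finType) (c : seq T) : {set {set T}} :=
  [set [set x; next c x] | x in c].

Definition hamiltonian_cycle (T : finType) (e : rel T) (H : {set {set T}}) :
    Prop :=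
  exists c : seq T,
    [/\ 3 <= size c, ucycle e c, forall x : T, x \in c & H = cycle_edges c].

Definition map_edges (T : finType) (f : {perm T}) (H : {set {set T}}) :
    {set {set T}} :=
  [set f @: A | A : {set T} in H].

Definition hamiltonian_transitive (T : finType) (e : rel T) : Prop :=
  (exists H, hamiltonian_cycle e H) /\
  (forall H1 H2, hamiltonian_cycle e H1 -> hamiltonian_cycle e H2 ->
     exists2 f : {perm T}, graph_aut e f & map_edges f H1 = H2).

Definition complete_graph (n : nat) : rel 'I_n := fun i j => i != j.

(* ordS is the successor modulo n. For n < 3 this is not a cycle. *)
Definition cycle_graph (n : nat) : rel 'I_n :=
  fun i j => (j == ordS i) || (i == ordS j).

Definition Cay (Gamma : finZmodType) (S : {set Gamma}) : rel Gamma :=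
  fun x y => (x - y)%R \in S.

Lemma complete_graph_sym n : symmetric (@complete_graph n).
Proof. by move=> i j; rewrite /complete_graph eq_sym. Qed.

Lemma complete_graph_irr n : irreflexive (@complete_graph n).
Proof. by move=> i; rewrite /complete_graph eqxx. Qed.

Lemma cycle_graph_sym n : symmetric (@cycle_graph n).
Proof. by move=> i j; rewrite /cycle_graph orbC. Qed.

Lemma cycle_graph_irr n : 1 < n -> irreflexive (@cycle_graph n).
Proof.
move=> n_gt1 i; rewrite /cycle_graph orbb; apply/negbTE/eqP => /(congr1 val) /=.
have [lt_i1n | le_n_i1] := ltnP i.+1 n.
  by rewrite modn_small // => /n_Sn.
have ->: i.+1 = n by apply/eqP; rewrite eqn_leq ltn_ord.
by rewrite modnn => i0; rewrite i0 leqNgt n_gt1 in le_n_i1.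
Qed.

Lemma Cay_sym (Gamma : finZmodType) (S : {set Gamma}) :
  S = [set (- x)%R | x in S] -> symmetric (Cay S).
Proof.
move=> SN; suff oppS z : z \in S -> (- z)%R \in S.
  by move=> x y; apply/idP/idP => /oppS; rewrite /Cay opprB.
by move=> zS; rewrite SN imset_f.
Qed.

Lemma Cay_irr (Gamma : finZmodType) (S : {set Gamma}) :
  0%R \notin S -> irreflexive (Cay S).
Proof. by move=> S0 x; rewrite /Cay subrr; apply/negbTE. Qed.

(* Main.v *)
Require Import Defs.
From HB Require Import structures.
From mathcomp Require Import all_boot all_order all_fingroup all_algebra.
From mathcomp Require Import cyclic zify.

(** Encode a Hamiltonian cycle by the cyclic word of its steps.  If Cay S is
    Hamiltonian-transitive, then for each k the number N_k of windows of k
    consecutive letters whose sum lies in S is the same for all Hamiltonian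
    words, because an automorphism matching two cycles matches their chords.

    Hamiltonian words are built by sweeping the cosets of a cyclic subgroup <s>
    as the levels of a tower.  Comparing two words that differ by a local change
    gives, for s, t in S with t outside <s> and [x] the indicator of S:
    - [2s] + [2t] = 2 [s + t] if s has order at least 5;
    - [s + t] = [t - s] if s has order 3.
    If some s in S has order at least 5, there is a word all of whose 2-windows
    have the indicator [2s], so N_2 is 0 or n.  As any two letters of S occur
    consecutively in some Hamiltonian word, S + {0} is closed under sums (and
    the graph is complete), or S is sum-free.  In the sum-free case N_3 gives
    s + 2t in S for t outside <s>; for s of maximal order, not a generator, this
    yields t + 2s, t + 4s, ..., t + s in S, a contradiction.  So some s generates
    Gamma, and a further element j s of S would give N_3 = n, hence 3s, 5s, ...,
    -2s in S; thus S = {s, -s}.  If all elements of S have order 3, N_3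
    distinguishes two ways of traversing <s, t> unless s + t is in S. *)

Set Implicit Arguments.
Unset Strict Implicit.
Unset Printing Implicit Defensive.

Import GRing.Theory FinRing.Theory.

(** * Chord counts of a cycle and their invariance under automorphisms *)

Lemma next_next_neq (T : eqType) (c : seq T) (x : T) :
  uniq c -> (2 < size c)%N -> x \in c -> next c (next c x) != x.
Proof.
move=> c_uniq c_gt2 xc; case/rot_to: (xc) => i p def_c.
rewrite -!(next_rot i c_uniq) def_c.
have: uniq (x :: p) by rewrite -def_c rot_uniq.
have: (2 < size (x :: p))%N by rewrite -def_c size_rot.
case: p {def_c} => [|y [|z p]] //= _ /and3P[].
rewrite !inE !negb_or eqxx => /and3P[xy xz _] /andP[yz _] _.
by rewrite [y == x]eq_sym (negbTE xy) eqxx eq_sym.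
Qed.

Section ChordCount.
Variables (T : finType) (e : rel T).
Hypothesis e_sym : symmetric e.

Definition chord_count (k : nat) (c : seq T) : nat :=
  \sum_(x : T) e x (iter k (next c) x).

Lemma chord_count_aut (c1 c2 : seq T) (f : {perm T}) (k : nat) :
    uniq c1 -> uniq c2 -> (2 < size c1)%N ->
    (forall x, x \in c1) -> (forall x, x \in c2) -> graph_aut e f ->
    map_edges f (cycle_edges c1) = cycle_edges c2 ->
  chord_count k c1 = chord_count k c2.
Proof.
move=> U1 U2 c1_gt2 in1 in2 f_aut f_edges.
pose g x := f (next c1 ((f^-1)%g x)).
have n2_inj : injective (next c2) := can_inj (prev_next U2).
have g2 x : g (g x) != x.
  rewrite /g permK -{2}[x](permKV f) (inj_eq perm_inj).
  exact: next_next_neq.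
(* g is a cyclic permutation with the same edges as next c2: it is next c2 or
   its inverse. *)
have g_step x : g x = next c2 x \/ next c2 (g x) = x.
  have: [set x; g x] \in cycle_edges c2.
    rewrite -f_edges; apply/imsetP; exists [set f^-1%g x; next c1 (f^-1%g x)].
      by apply/imsetP; exists (f^-1%g x).
    by rewrite imsetU1 imset_set1 permKV.
  case/imsetP=> z _ eq_xz.
  have z_in: z \in [set x; g x] by rewrite eq_xz set21.
  have nz_in: next c2 z \in [set x; g x] by rewrite eq_xz set22.
  have: x \in [set z; next c2 z] by rewrite -eq_xz set21.
  have: g x \in [set z; next c2 z] by rewrite -eq_xz set22.
  rewrite !in_set2 => /orP[]/eqP gx /orP[]/eqP xE.
  - by move: nz_in; rewrite in_set2 gx {1}xE orbb => /eqP nz; left; rewrite xE nz.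
  - by right; rewrite gx.
  - by left; rewrite gx xE.
  - by move: z_in; rewrite in_set2 gx {1}xE orbb => /eqP zE; left; rewrite xE -zE.
have iter_f x : f (iter k (next c1) x) = iter k g (f x).
  by elim: k => //= k <-; rewrite /g permK.
rewrite /chord_count.
under eq_bigr => x _ do rewrite -f_aut iter_f.
rewrite -[LHS](reindex_inj (@perm_inj _ f) (P := predT)
                 (F := fun y => nat_of_bool (e y (iter k g y)))).
(* One forward step forces the following one to be forward too, since turning back would give
   [g (g x) = x]; hence [g] is [next c2] everywhere. *)
have [/existsP[x0 /eqP g_x0]|] := boolP [exists x, g x == next c2 x].
  suff gE x : g x = next c2 x by apply: eq_bigr => x _; rewrite (eq_iter gE).
  have: fconnect (next c2) x0 x.
    by rewrite (fconnect_cycle (cycle_next U2)) ?in2.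
  move/iter_findex <-; elim: (findex _ _ _) => //= i IHi.
  have [//|/n2_inj] := g_step (next c2 (iter i (next c2) x0)).
  by rewrite -{1}IHi => gg; case/eqP: (g2 (iter i (next c2) x0)).
rewrite negb_exists => /forallP no_next.
have gK x : next c2 (g x) = x.
  by case: (g_step x) => // /eqP gx; have:= no_next x; rewrite gx.
have iter_gK j x : iter j (next c2) (iter j g x) = x.
  by elim: j x => //= j IHj x; rewrite -iterS iterSr gK.
(* Here [g] runs backward everywhere: each chord is read from its other end, and [e_sym] gives the
   same indicator. *)
rewrite [RHS](reindex_inj (h := iter k g)) /=; last exact: can_inj (iter_gK k).
by apply: eq_bigr => x _; rewrite iter_gK e_sym.
Qed.

End ChordCount.

(** * Words of steps and their window counts *)

Section Words.
Local Open Scope ring_scope.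
Variable Gamma : finZmodType.
Implicit Types (S : {set Gamma}) (w : seq Gamma) (x y : Gamma).

Definition word_sum w : Gamma := \sum_(x <- w) x.

Lemma word_sum_cons x w : word_sum (x :: w) = x + word_sum w.
Proof. by rewrite /word_sum big_cons. Qed.

Lemma word_sum_nil : word_sum [::] = 0.
Proof. by rewrite /word_sum big_nil. Qed.

Lemma word_sum_cat w1 w2 : word_sum (w1 ++ w2) = word_sum w1 + word_sum w2.
Proof. by rewrite /word_sum big_cat. Qed.

Lemma word_sum_nseq k x : word_sum (nseq k x) = x *+ k.
Proof. by elim: k => [|k IHk] /=; rewrite ?word_sum_nil // word_sum_cons IHk mulrS. Qed.

Definition word_sumE := (word_sum_nil, word_sum_cons, word_sum_cat, word_sum_nseq).

Lemma foldl_word_sum x w : foldl +%R x w = x + word_sum w.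
Proof.
elim: w x => [|y w IHw] x /=; first by rewrite word_sum_nil addr0.
by rewrite IHw word_sum_cons addrA.
Qed.

Lemma mem_scanl_shift x y w : (x + y \in scanl +%R x w) = (y \in scanl +%R 0 w).
Proof.
have ->: scanl +%R x w = [seq x + z | z <- scanl +%R 0 w].
  rewrite -{1}[x]addr0; elim: w {y} 0 => //= z w IHw y.
  by rewrite -addrA IHw.
by rewrite mem_map //; apply: addrI.
Qed.

Lemma mem_scanl x v w : (v \in scanl +%R x w) = (v - x \in scanl +%R 0 w).
Proof. by rewrite -(mem_scanl_shift x) subrKC. Qed.

Lemma mem_scanl_cat x v w1 w2 :
  (v \in scanl +%R x (w1 ++ w2)) =
  (v \in scanl +%R x w1) || (v \in scanl +%R (x + word_sum w1) w2).
Proof. by rewrite scanl_cat mem_cat foldl_word_sum. Qed.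

Lemma mem_scanl_nseq x v y k :
  (exists2 i, (0 < i <= k)%N & v = x + y *+ i) -> v \in scanl +%R x (nseq k y).
Proof.
elim: k x v => [|k IHk] x v [i] //=; first by case: i.
case: i => [//|[|i]] /= lt_ik ->; first by rewrite mem_head.
rewrite in_cons IHk ?orbT //; exists i.+1 => //; by rewrite -addrA -mulrS.
Qed.

Lemma mem_scanl_last x w : w != [::] -> x + word_sum w \in scanl +%R x w.
Proof.
case/lastP: w => // w y _.
by rewrite scanl_rcons foldl_word_sum mem_rcons mem_head.
Qed.

(* A Hamiltonian cycle of Cay S through 0 is encoded by the word of its steps;
   scanl +%R 0 w lists the vertices visited after each step, ending at 0. *)
Definition ham_word S w :=
  [/\ {subset w <= S}, word_sum w = 0, size w = #|Gamma|
    & forall v, v \in scanl +%R 0 w].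

(** Letters are indexed cyclically, so that [i] may run past the end of the word. *)
Definition vertex w i : Gamma := \sum_(j < i) nth 0 w (j %% size w).

Lemma vertex_take w i : (i <= size w)%N -> vertex w i = word_sum (take i w).
Proof.
move=> le_iw; rewrite /word_sum (big_nth 0) size_takel // big_mkord.
apply: eq_bigr => j _; have lt_ji := ltn_ord j.
by rewrite modn_small ?nth_take //; apply: leq_trans le_iw.
Qed.

Lemma vertexD w i k :
  vertex w (i + k) = vertex w i + \sum_(j < k) nth 0 w ((i + j) %% size w).
Proof. by rewrite /vertex big_split_ord. Qed.

Lemma vertex_size w i : vertex w (size w + i) = word_sum w + vertex w i.
Proof.
rewrite vertexD vertex_take // take_size; congr (_ + _).
by apply: eq_bigr => j _; rewrite modnDl.
Qed.

Lemma vertex_modn w i : word_sum w = 0 -> vertex w (i %% size w) = vertex w i.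
Proof.
move=> w0; rewrite {2}(divn_eq i (size w)).
by elim: (_ %/ _)%N => // q IHq; rewrite mulSn -addnA vertex_size w0 add0r.
Qed.

Definition vertices w := mkseq (vertex w) (size w).

Lemma size_vertices w : size (vertices w) = size w.
Proof. by rewrite size_mkseq. Qed.

Section HamWord.
Variables (S : {set Gamma}) (w : seq Gamma).
Hypothesis w_ham : ham_word S w.

Lemma mem_vertices v : v \in vertices w.
Proof.
have [_ w0 _ /(_ v)] := w_ham.
case/(nthP 0) => i; rewrite size_scanl => lt_iw <-.
rewrite nth_scanl // foldl_word_sum add0r -vertex_take //.
rewrite -vertex_modn //; apply: map_f; rewrite mem_iota /= ltn_mod.
by apply: leq_trans lt_iw.
Qed.

(** By pigeonhole: a list of [#|Gamma|] entries that covers [Gamma] has no repetition. *)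
Lemma vertices_uniq : uniq (vertices w).
Proof.
have [_ _ w_size _] := w_ham.
apply: (leq_size_uniq (enum_uniq Gamma)) => [x _|]; first exact: mem_vertices.
by rewrite size_vertices w_size cardE.
Qed.

Lemma next_vertex i : next (vertices w) (vertex w i) = vertex w i.+1.
Proof.
have [_ w0 w_size _] := w_ham.
have w_gt0 : (0 < size w)%N.
  by rewrite w_size; apply/card_gt0P; exists 0.
rewrite -(vertex_modn i) // -[RHS]vertex_modn // -addn1 -modnDml addn1.
have: (i %% size w < size w)%N by rewrite ltn_mod.
set j := (i %% size w)%N => lt_jw.
rewrite next_nth mem_vertices -{2}(nth_mkseq 0 (vertex w) lt_jw).
rewrite index_uniq ?size_mkseq //; last exact: vertices_uniq.
rewrite vertex_modn //.
rewrite /vertices /mkseq; case: (size w) w_gt0 lt_jw (vertex_size w) => //= m _.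
rewrite ltnS leq_eqVlt => /orP[/eqP -> vS|lt_jm _].
  (* At the last index [nth] falls back on its default, the first vertex; this is
     [vertex w (size w)] because the word sums to 0. *)
  by rewrite nth_default ?size_map ?size_iota // -[m.+1]addn0 vS w0 add0r.
by rewrite (nth_map 0%N) ?size_iota // nth_iota.
Qed.

Lemma iter_next_vertex k i :
  iter k (next (vertices w)) (vertex w i) = vertex w (i + k).
Proof. by elim: k => [|k IHk] /=; rewrite ?addn0 // IHk next_vertex addnS. Qed.

Lemma ham_word_cycle :
    (2 < #|Gamma|)%N -> (forall x, (- x \in S) = (x \in S)) ->
  hamiltonian_cycle (Cay S) (cycle_edges (vertices w)).
Proof.
move=> n_gt2 S_opp; have [wS w0 w_size _] := w_ham.
exists (vertices w); split=> //; last exact: mem_vertices.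
  by rewrite size_vertices w_size.
rewrite /ucycle vertices_uniq andbT.
have w_gt0 : (0 < size w)%N by rewrite w_size ltnW // ltnW.
apply/(sub_cycle _ (cycle_next vertices_uniq)) => x y /= /eqP <-.
have /mapP[i _ ->] := mem_vertices x.
rewrite next_vertex /Cay -addn1 vertexD big_ord1 opprD addNKr S_opp.
by apply/wS/mem_nth; rewrite ltn_mod.
Qed.

End HamWord.

Definition window k w i : Gamma := \sum_(j < k) nth 0 w ((i + j) %% size w).

Definition nwin S k w : nat := (\sum_(i < size w) (window k w i \in S))%N.

Lemma nwin_chord_count S k w :
    (forall x, (- x \in S) = (x \in S)) -> ham_word S w ->
  nwin S k w = chord_count (Cay S) k (vertices w).
Proof.
move=> S_opp w_ham; rewrite /chord_count.
transitivity (\sum_(x <- vertices w) Cay S x (iter k (next (vertices w)) x))%N.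
  rewrite big_map -[in iota _ _](subn0 (size w)) -/(index_iota 0 _) big_mkord.
  apply: eq_bigr => i _; rewrite (iter_next_vertex w_ham) vertexD /Cay.
  by rewrite opprD addNKr S_opp.
rewrite big_uniq ?(vertices_uniq w_ham) //.
by apply: eq_bigl => x; rewrite (mem_vertices w_ham).
Qed.

Lemma nwin_invariant S k w1 w2 :
    (2 < #|Gamma|)%N -> S = [set - x | x in S] ->
    hamiltonian_transitive (Cay S) -> ham_word S w1 -> ham_word S w2 ->
  nwin S k w1 = nwin S k w2.
Proof.
move=> n_gt2 S_opp [_ trans] ham1 ham2.
have oppS x : (- x \in S) = (x \in S).
  by rewrite {1}S_opp -{1}[x]opprK mem_imset ?opprK //; apply: oppr_inj.
rewrite !nwin_chord_count //.
have [f f_aut f_edges] :=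
  trans _ _ (ham_word_cycle ham1 n_gt2 oppS) (ham_word_cycle ham2 n_gt2 oppS).
apply: chord_count_aut f_edges; rewrite ?size_vertices //.
- exact: Cay_sym.
- exact: vertices_uniq ham1.
- exact: vertices_uniq ham2.
- by case: ham1 => _ _ ->.
- exact: mem_vertices ham1.
- exact: mem_vertices ham2.
Qed.

Lemma window_cat k u z v :
  size z = k -> window k (u ++ z ++ v) (size u) = word_sum z.
Proof.
move=> z_size; rewrite /word_sum (big_nth 0) z_size big_mkord.
apply: eq_bigr => j _; have lt_jk := ltn_ord j.
rewrite !size_cat modn_small ?z_size; last by lia.
by rewrite nth_cat ltnNge leq_addr addKn nth_cat z_size lt_jk.
Qed.

(** A count of 0 or of [size w] leaves no freedom to single windows, so one occurrence of [z]
    decides whether its sum lies in [S]. *)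
Lemma nwin_full S k (c : bool) w u z v :
    nwin S k w = (c * size w)%N -> w = u ++ z ++ v -> size z = k ->
    z != [::] -> (word_sum z \in S) = c.
Proof.
move=> Nw w_def z_size z_neq0; rewrite -(window_cat u v z_size) -w_def.
have lt_uw : (size u < size w)%N.
  by rewrite w_def !size_cat; case: (z) z_neq0 => //= *; lia.
pose F i := window k w i \in S.
have: nwin S k w = (F (size u) + \sum_(i < size w | i != Ordinal lt_uw) F i)%N.
  by rewrite /nwin (bigD1 (Ordinal lt_uw)).
have : (\sum_(i < size w | i != Ordinal lt_uw) F i <= (size w).-1)%N.
  apply: leq_trans (_ : \sum_(i < size w | i != Ordinal lt_uw) 1 <= _)%N.
    by apply: leq_sum => i _; apply: leq_b1.
  by rewrite sum1_card cardC1 card_ord.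
rewrite Nw -/(F _); case: (F _); case: (c) => //; lia.
Qed.

Lemma nwin_const S k (c : bool) w :
  (forall i, window k w i \in S = c) -> nwin S k w = (c * size w)%N.
Proof.
move=> F_c; rewrite /nwin; under eq_bigr => i _ do rewrite F_c.
by rewrite sum_nat_const card_ord mulnC.
Qed.

(* Linear versions of nwin S 2 and nwin S 3, for the words x :: w and
   [:: x, y & w]; they can be evaluated piecewise. *)
Fixpoint nwin2 S x w : nat :=
  if w is y :: w' then (x + y \in S) + nwin2 S y w' else 0.

Fixpoint nwin3 S x y w : nat :=
  if w is z :: w' then (x + y + z \in S) + nwin3 S y z w' else 0.

(** Splitting at a shared letter lets the long common parts of two words cancel without being
    evaluated. *)
Lemma nwin2_cat S x w1 y w2 :
  nwin2 S x (w1 ++ y :: w2) = (nwin2 S x (rcons w1 y) + nwin2 S y w2)%N.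
Proof. by elim: w1 x => [|z w1 IHw] x /=; rewrite ?addn0 // IHw addnA. Qed.

Lemma nwin3_cat S x y w1 z t v w2 :
  nwin3 S x y (w1 ++ [:: z, t, v & w2]) =
  (nwin3 S x y (w1 ++ [:: z; t]) + nwin3 S z t (v :: w2))%N.
Proof.
elim: w1 x y => [|u w1 IHw] x y; last by rewrite /= IHw addnA.
by rewrite /= addn0 !addnA.
Qed.

Lemma nwin2_sum S x w :
  nwin2 S x w = (\sum_(i < size w) ((nth 0 (x :: w) i + nth 0 w i)%R \in S))%N.
Proof. by elim: w x => [|y w IHw] x; rewrite ?big_ord0 // big_ord_recl /= IHw. Qed.

Lemma nwin3_sum S x y w :
  nwin3 S x y w =
  (\sum_(i < size w)
     ((nth 0 [:: x, y & w] i + nth 0 (y :: w) i + nth 0 w i)%R \in S))%N.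
Proof. by elim: w x y => [|z w IHw] x y; rewrite ?big_ord0 // big_ord_recl /= IHw. Qed.

(** Repeating the first letter at the end accounts for the window that wraps around; [nwin3E]
    repeats two letters for the same reason. *)
Lemma nwin2E S x w : nwin S 2 (x :: w) = nwin2 S x (rcons w x).
Proof.
rewrite nwin2_sum size_rcons; apply: eq_bigr => -[i lt_iw] _.
rewrite /window 2!big_ord_recl big_ord0 addr0 /= addn0 /bump /= addn1 modn_small //.
rewrite -rcons_cons nth_rcons /= lt_iw nth_rcons; congr (nat_of_bool (_ + _ \in S)).
move: lt_iw; rewrite ltnS leq_eqVlt => /orP[/eqP ->|lt_iw].
  by rewrite modnn ltnn eqxx.
by rewrite modn_small ?ltnS // lt_iw.
Qed.

Lemma nwin3E S x y w : nwin S 3 [:: x, y & w] = nwin3 S x y (w ++ [:: x; y]).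
Proof.
set l := [:: x, y & w]; pose l2 := l ++ [:: x; y].
have l2E a : (a < (size l).+2)%N -> nth 0 l (a %% size l) = nth 0 l2 a.
  move=> lt_a; rewrite nth_cat; case: ltnP => [/modn_small-> // | le_a].
  have lt_b : (a - size l < 2)%N by lia.
  rewrite -[in LHS](subnKC le_a) modnDl modn_small; last exact: leq_trans lt_b _.
  by case: (a - size l)%N lt_b => [|[]].
rewrite nwin3_sum size_cat addn2; apply: eq_bigr => -[i /= lt_iw] _.
rewrite /window 3!big_ord_recl big_ord0 addr0 /= addn0 /bump /= addn1 addn2.
by rewrite -/(size l) !l2E ?addrA //=; lia.
Qed.

End Words.

(** * Caps: sweeping cosets above a single edge *)

Section Caps.
Local Open Scope ring_scope.
Variables (Gamma : finZmodType) (S : {set Gamma}).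
Hypothesis oppS : forall x, (- x \in S) = (x \in S).
Implicit Types (s t x v : Gamma) (w ts : seq Gamma) (A : {group Gamma}).

Lemma mem_group0 A : 0 \in A.
Proof. exact: (group1 A). Qed.

Lemma mem_groupD A x y : x \in A -> y \in A -> x + y \in A.
Proof. exact: (@groupM _ A). Qed.

Lemma mem_groupN A x : (- x \in A) = (x \in A).
Proof. exact: (@groupV _ A). Qed.

Lemma mem_groupDr A x y : x \in A -> (y + x \in A) = (y \in A).
Proof. exact: (@groupMr _ A). Qed.

Lemma mem_groupMn A x k : x \in A -> x *+ k \in A.
Proof. by rewrite -zmodXgE; apply: groupX. Qed.

Lemma mem_group_word A w : {subset w <= A} -> word_sum w \in A.
Proof.
elim: w => [|x w IHw] wA; rewrite !word_sumE ?mem_group0 //.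
apply: mem_groupD; first by rewrite wA ?mem_head.
by apply: IHw => y yw; rewrite wA // in_cons yw orbT.
Qed.

Lemma mulrn_order s : s *+ #[s]%g = 0.
Proof. by rewrite -zmodXgE expg_order. Qed.

Lemma order_opp s : #[- s]%g = #[s]%g.
Proof. by rewrite -zmodVgE orderV. Qed.

Lemma cycle_opp s : <[- s]>%g = <[s]>%g.
Proof. by rewrite -zmodVgE cycleV. Qed.

Lemma mem_cycle_mulrn s x :
  x \in <[s]>%g -> exists2 i, (i < #[s]%g)%N & x = s *+ i.
Proof. by case/cyclePmin => i lt_i ->; exists i; rewrite ?zmodXgE. Qed.

Lemma mulrn_mem_cycle s i : s *+ i \in <[s]>%g.
Proof. by rewrite mem_groupMn ?cycle_id. Qed.

(* Think of the cosets of <[s]> met by the path ts as levels. A cap is an excursion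
   from 0 to the neighbouring vertex s which sweeps all levels above. *)
Definition is_cap s ts (C : seq Gamma) :=
  [/\ {subset C <= S}, word_sum C = s, size C = (#[s]%g * size ts).+1
    & forall p v, p \in scanl +%R 0 ts -> v - p \in <[s]>%g ->
        v \in scanl +%R 0 C].

Lemma is_cap_nil s : s \in S -> is_cap s [::] [:: s].
Proof.
by move=> sS; split; rewrite ?word_sumE ?addr0 ?muln0 // => x; rewrite inE => /eqP->.
Qed.

(* Climb t, go around the new level the long way, and let the cap C over the edge
   between two consecutive vertices interrupt the tour so that k steps remain. *)
Definition cap_level s k t (C : seq Gamma) :=
  t :: nseq (#[s]%g - 2 - k) (- s) ++ C ++ rcons (nseq k (- s)) (- t).

Lemma mulrn_opp_order s i j : (i + j = #[s]%g)%N -> (- s) *+ i = s *+ j.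
Proof.
by move=> ij; apply/eqP; rewrite mulNrn eq_sym -addr_eq0 addrC -mulrnDr ij mulrn_order.
Qed.

(** The inner cap has sum [- s] and so replaces one step of the tour: [#[s] - 1] steps [- s] in all,
    which add up to [s]. *)
Lemma is_cap_level s k t ts C :
    (k + 2 <= #[s]%g)%N -> s \in S -> t \in S -> is_cap (- s) ts C ->
  is_cap s (t :: ts) (cap_level s k t C).
Proof.
move=> le_k sS tS [CS C_sum C_size C_cover]; set m := #[s]%g in le_k *.
split.
- move=> x; rewrite /cap_level in_cons !mem_cat mem_rcons in_cons !mem_nseq.
  by case/or4P=> [/eqP->|/andP[_ /eqP->]|/CS|/orP[/eqP->|/andP[_ /eqP->]]] //;
    rewrite oppS.
- rewrite !word_sumE C_sum -cats1 !word_sumE addr0.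
  rewrite !addrA -[t + _ + _]addrA -mulrSr -[t + _ + _]addrA -mulrnDr addrC.
  by rewrite addKr (mulrn_opp_order (j := 1)) // -/m; lia.
- rewrite /= !size_cat size_rcons !size_nseq C_size order_opp -/m mulnS; lia.
move=> p v; rewrite /= add0r in_cons => p_in.
rewrite /cap_level /= in_cons ?add0r !mem_scanl_cat word_sum_nseq C_sum.
(* The inner cap starts at [y]. A vertex in the coset of [t] is visited up to [y], at the end
   [y - s] of the inner cap, or after it. *)
set y := t + _ => vp; have [/eqP p_t | p_t] := boolP (p == t).
  have [|i lt_im vE] := @mem_cycle_mulrn (- s) (v - p); first by rewrite cycle_opp.
  have {}vE : v = t + (- s) *+ i by rewrite -vE p_t addrC subrK.
  rewrite order_opp -/m in lt_im.
  have [i0|i_gt0] := posnP i; first by rewrite vE i0 addr0 eqxx.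
  have [le_i|gt_i] := leqP i (m - 2 - k).
    by rewrite (@mem_scanl_nseq _ t) ?orbT //; exists i; rewrite ?i_gt0.
  have yE : y - s = t + (- s) *+ (m - 1 - k).
    by rewrite /y -addrA -mulrSr; congr (_ + _ *+ _); lia.
  have [i_def|gt_i2] := leqP i (m - 1 - k).
    have {i_def} -> : v = y - s by rewrite yE vE; congr (_ + _ *+ _); lia.
    by rewrite -C_sum mem_scanl_last ?orbT //; case: (C) C_size.
  rewrite -cats1 mem_scanl_cat (@mem_scanl_nseq _ (y - s)) ?orbT //.
  exists (i - (m - 1 - k))%N; first by lia.
  by rewrite yE vE -addrA -mulrnDr; congr (_ + _ *+ _); lia.
(* The higher levels are swept by the inner cap translated by [y]; as [y - t] lies in [<[s]>], the
   cosets do not change. *)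
have {p_t} p_in: p \in scanl +%R t ts by rewrite (negbTE p_t) in p_in.
rewrite mem_scanl in p_in; rewrite (mem_scanl y).
rewrite (C_cover _ _ p_in) ?orbT // cycle_opp.
rewrite /y mulNrn !opprB -[_ + _ + (t - p)]addrA [_ + (t - p)]addrA subrK.
by rewrite [_ - p]addrC addrA mem_groupDr ?mulrn_mem_cycle.
Qed.

(** The sign alternates because the inner cap stands over a step [- s]. If [s] has order above 3,
    [k = 1] leaves letters [- s] on both sides of the inner cap, so that two level changes are never
    consecutive. *)
Fixpoint cap s ts :=
  if ts is t :: ts' then cap_level s 1 t (cap (- s) ts') else [:: s].

Lemma is_cap_cap s ts :
    s \in S -> {subset ts <= S} -> (2 < #[s]%g)%N -> is_cap s ts (cap s ts).
Proof.
elim: ts s => [|t ts IHts] s sS tsS s_gt2 /=; first exact: is_cap_nil.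
apply: is_cap_level => //; first by rewrite tsS ?mem_head.
by apply: IHts; rewrite ?oppS ?order_opp // => x xts; rewrite tsS // in_cons xts orbT.
Qed.

(* Started at 0 in A, r visits each coset of <[s]> outside A; by the size condition
   exactly once. *)
Definition is_coset_path s A (r : seq Gamma) :=
  [/\ {subset r <= S :\: <[s]>%g}, (size r * #[s]%g + #|A| = #|Gamma|)%N
    & forall v, v \notin A -> exists2 p, p \in scanl +%R 0 r & v - p \in <[s]>%g].

(** The path [x] through [A] ends at [- s]; the cap [R] closes it over the edge from [- s] to 0 and
    sweeps the complement of [A] on the way. *)
Lemma ham_word_cap s A (x r R : seq Gamma) :
    s \in A -> is_coset_path s A r -> is_cap s r R ->
    {subset x <= S} -> word_sum x = - s -> (size x).+1 = #|A| ->
    (forall v, v \in A -> v \in 0 :: scanl +%R 0 x) ->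
  ham_word S (x ++ R).
Proof.
move=> sA [_ r_size r_cover] [RS R_sum R_size R_cover] xS x_sum x_size x_cover.
split.
- by move=> v; rewrite mem_cat => /orP[/xS|/RS].
- by rewrite word_sum_cat x_sum R_sum addNr.
- rewrite size_cat R_size -r_size -x_size; lia.
move=> v; rewrite mem_scanl_cat add0r x_sum.
have [vA | vA] := boolP (v \in A).
  have := x_cover v vA; rewrite in_cons => /orP[/eqP->|->] //.
  rewrite -[X in X \in scanl _ (- s) _](addNr s) -{2}R_sum.
  by rewrite mem_scanl_last ?orbT //; case: (R) R_size.
have [|p p_in vp] := r_cover (v + s); first by rewrite mem_groupDr.
by rewrite (mem_scanl (- s)) opprK (R_cover _ _ p_in vp) orbT.
Qed.

End Caps.

(** * Paths through the cosets of a cyclic subgroup *)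

Section CosetPaths.
Local Open Scope ring_scope.
Variables (Gamma : finZmodType) (S : {set Gamma}).
Hypothesis S_gen : <<S>>%g = [set: Gamma].
Hypothesis n_odd : odd #|Gamma|.
Implicit Types (s t u x v : Gamma) (w ts : seq Gamma) (A : {group Gamma}).

Lemma odd_card_group A : odd #|A|.
Proof.
apply: dvdn_odd n_odd; rewrite -cardsT.
exact: (cardSg (subsetT A : A \subset [set: Gamma]%G)).
Qed.

Lemma gen_full A : S \subset A -> A = [set: Gamma]%G.
Proof.
by move=> SA; apply/eqP; rewrite -val_eqE /= eqEsubset subsetT -S_gen gen_subG.
Qed.

(** The quotient by [A] is cyclic, generated by the image of [u], and [M] is the order of that
    image. *)
Lemma join_cycle_coset A u :
  exists2 M, #|A <*> <[u]>|%g = (M * #|A|)%N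
    & forall v, v \in (A <*> <[u]>)%g ->
        exists2 k, (k < M)%N & v - u *+ k \in A.
Proof.
have nA v : v \in 'N(A)%g.
  by apply/(subsetP (cent_sub A))/centP => x _; apply: (zmod_mulgC v).
have nuA : (<[u]> \subset 'N(A))%g by rewrite cycle_subG.
have quoE : (<[u]> / A)%g = <[coset A u]>%g by rewrite /quotient morphim_cycle.
exists #[coset A u]%g.
  rewrite /order -quoE -(quotientYidl nuA) card_quotient.
    by rewrite mulnC Lagrange ?joing_subl.
  by rewrite join_subG normG.
move=> v vB; have: coset A v \in <[coset A u]>%g.
  by rewrite -quoE -(quotientYidl nuA) mem_quotient.
case/cyclePmin => k lt_k; rewrite -morphX // => eq_coset; exists k => //.
have /rcosetP[a aA ->]: v \in (A :* (u ^+ k))%g.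
  by apply/rcoset_kercosetP; rewrite ?nA.
by rewrite zmodMgE zmodXgE addrK.
Qed.

(** The starting coset [<[s]>] is counted too, hence [0 ::] and [(size ts).+1]. *)
Definition is_inner_path s A (ts : seq Gamma) :=
  [/\ s \in A, {subset ts <= S :\: <[s]>%g}, {subset ts <= A},
      ((size ts).+1 * #[s]%g = #|A|)%N
    & forall v, v \in A ->
        exists2 p, p \in 0 :: scanl +%R 0 ts & v - p \in <[s]>%g].

Lemma mem_scanl_flatten_nseq w p j k :
    p \in scanl +%R 0 w -> (j < k)%N ->
  p + word_sum w *+ j \in scanl +%R 0 (flatten (nseq k w)).
Proof.
move=> p_in; elim: k j => [//|k IHk] [|j] lt_jk /=; rewrite mem_scanl_cat add0r.
  by rewrite addr0 p_in.
by rewrite (mem_scanl (word_sum w)) mulrSr addrA addrK IHk // orbT.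
Qed.

(** Each repetition of [u :: ts] moves to the next coset of [A] and tours it. The index of [A] in
    the join is odd and not 1, so there are at least two repetitions. *)
Lemma inner_path_step s A ts u :
    is_inner_path s A ts -> u \in S -> u \notin A ->
  exists M, let r := flatten (nseq M.+2 (u :: ts)) in
    is_inner_path s (A <*> <[u]>) (ts ++ r)
    /\ forall v, v \in (A <*> <[u]>)%g -> v \notin A ->
         exists2 p, p \in scanl +%R 0 r & v - p \in <[s]>%g.
Proof.
move=> [sA tsS tsA ts_size ts_cover] uS uA.
have u's : u \in S :\: <[s]>%g.
  by rewrite inE uS andbT; apply: contra uA; apply/subsetP; rewrite cycle_subG.
have [M B_card B_cover] := join_cycle_coset A u.
have sAB : (A \subset A <*> <[u]>)%g by apply: joing_subl.
have uB : u \in (A <*> <[u]>)%g.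
  by apply/(subsetP (joing_subr _ _))/cycle_id.
have M_gt2 : (2 < M)%N.
  have := odd_card_group (A <*> <[u]>)%G; rewrite /= B_card oddM => /andP[M_odd _].
  case: M M_odd B_card {B_cover} => [|[|[|M]]] //= _; rewrite mul1n => B_card.
  case/negP: uA; suff ->: A = (A <*> <[u]>)%G by [].
  by apply/eqP; rewrite -val_eqE /= eqEcard sAB B_card leqnn.
exists (M - 3)%N; have ->: (M - 3).+2 = M.-1 by lia.
set r := flatten _.
have r_sub (P : {pred Gamma}) : {subset u :: ts <= P} -> {subset r <= P}.
  by move=> sub x /flattenP[w]; rewrite mem_nseq => /andP[_ /eqP->] /sub.
have r_cover v : v \in (A <*> <[u]>)%g -> v \notin A ->
    exists2 p, p \in scanl +%R 0 r & v - p \in <[s]>%g.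
  move=> vB vA; have [[|j] lt_j vj] := B_cover v vB.
    by rewrite subr0 (negbTE vA) in vj.
  pose W := word_sum (u :: ts).
  (* After [j] repetitions the path is at [W *+ j], which is [u *+ j] modulo [A]. *)
  have v'A : v - W *+ j - u \in A.
    have ->: v - W *+ j - u = v - u *+ j.+1 - word_sum ts *+ j.
      rewrite /W word_sum_cons mulrnDl mulrS !opprD !addrA.
      by rewrite [LHS]addrAC [v - _ - u]addrAC.
    by rewrite mem_groupDr // mem_groupN mem_groupMn // mem_group_word.
  have [q q_in vq] := ts_cover _ v'A.
  exists (u + q + W *+ j).
    apply: mem_scanl_flatten_nseq; last by case: (M) lt_j.
    rewrite /= add0r in_cons; move: q_in; rewrite in_cons => /orP[/eqP->|q_in].
      by rewrite addr0 eqxx.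
    by rewrite mem_scanl_shift q_in orbT.
  by rewrite [_ + W *+ j]addrC !opprD !addrA.
split=> //; split.
- exact: (subsetP sAB).
- move=> x; rewrite mem_cat => /orP[/tsS //|].
  by apply: r_sub => y; rewrite in_cons => /orP[/eqP->|/tsS].
- move=> x; rewrite mem_cat => /orP[/tsA xA|]; first exact: (subsetP sAB).
  by apply: r_sub => y; rewrite in_cons => /orP[/eqP->//|/tsA]; apply: (subsetP sAB).
- rewrite B_card -ts_size size_cat size_flatten /shape map_nseq sumn_nseq /=; nia.
move=> v vB; have [vA|vA] := boolP (v \in A).
  have [p p_in vp] := ts_cover v vA; exists p => //.
  by move: p_in; rewrite !in_cons mem_scanl_cat => /orP[|] ->; rewrite ?orbT.
have sumA : word_sum ts \in A by apply: mem_group_word.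
have [||p p_in vp] := r_cover (v - word_sum ts).
- by rewrite mem_groupDr // mem_groupN (subsetP sAB).
- by rewrite mem_groupDr // mem_groupN.
exists (word_sum ts + p); last by rewrite opprD addrA.
by rewrite in_cons mem_scanl_cat add0r mem_scanl_shift p_in !orbT.
Qed.

Lemma inner_path_cycle s : is_inner_path s <[s]> [::].
Proof.
split=> //; rewrite ?cycle_id ?mul1n //.
by move=> v vs; exists 0; rewrite ?mem_head ?subr0.
Qed.

(** [A] is enlarged by one generator at a time, by induction on [#|Gamma| - #|A|]. The first two
    blocks are exposed because later window counts depend on the letters of the first levels. *)
Lemma coset_path_exists s A ts u :
    is_inner_path s A ts -> u \in S -> u \notin A ->
  exists r, is_coset_path S s A (u :: ts ++ u :: ts ++ r).
Proof.
have [d] := ubnP (#|Gamma| - #|A|); elim: d => // d IHd in A ts u *.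
rewrite ltnS => le_d A_path uS uA.
have [M [B_path B_cover]] := inner_path_step A_path uS uA.
set B := (A <*> <[u]>)%G in B_path B_cover.
set r1 := flatten _ in B_path B_cover.
pose r0 := flatten (nseq M (u :: ts)).
have r1E : r1 = u :: ts ++ u :: ts ++ r0 by [].
have [_ tsS tsA ts_size _] := A_path.
have [_ B_S B_sub B_size _] := B_path.
have r1S : {subset r1 <= S :\: <[s]>%g}
  by move=> x x_r1; rewrite B_S // mem_cat x_r1 orbT.
have r1_sum : word_sum r1 \in B.
  by apply: mem_group_word => x x_r1; rewrite B_sub // mem_cat x_r1 orbT.
have r1_size : (size r1 * #[s]%g + #|A| = #|B|)%N.
  rewrite -B_size -ts_size size_cat; lia.
have [SB | /subsetPn[u' u'S u'B]] := boolP (S \subset B).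
  have BT := gen_full SB.
  exists r0; rewrite -r1E; split=> //.
    by rewrite r1_size BT cardsT.
  move=> v vA; apply: B_cover => //; have: v \in B by rewrite BT in_setT.
  by [].
have lt_AB : (#|A| < #|B|)%N.
  apply: proper_card; rewrite properE joing_subl; apply/subsetPn; exists u => //.
  exact/(subsetP (joing_subr _ _))/cycle_id.
have le_B : (#|B| <= #|Gamma|)%N by rewrite -cardsT subset_leq_card ?subsetT.
have [|r' [r2S r2_size r2_cover]] := IHd B _ u' _ B_path u'S u'B; first by lia.
set r2 := (X in size X) in r2S r2_size r2_cover.
exists (r0 ++ r2).
have ->: u :: ts ++ u :: ts ++ r0 ++ r2 = r1 ++ r2 by rewrite r1E /= -!catA /= -!catA.
split.
- by move=> x; rewrite mem_cat => /orP[/r1S|/r2S].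
- rewrite size_cat -r2_size -r1_size; lia.
move=> v vA; have [vB|vB] := boolP (v \in B).
  have [p p_in vp] := B_cover v vB vA; exists p => //.
  by rewrite mem_scanl_cat p_in.
have [|p p_in vp] := r2_cover (v - word_sum r1).
  by rewrite mem_groupDr // mem_groupN.
exists (word_sum r1 + p); last by rewrite opprD addrA.
by rewrite mem_scanl_cat add0r mem_scanl_shift p_in orbT.
Qed.

Lemma coset_path_nil s A : A = [set: Gamma]%G -> is_coset_path S s A [::].
Proof. by move=> ->; split; rewrite ?cardsT // => v; rewrite in_setT. Qed.

Lemma coset_path_cycle s : exists r, is_coset_path S s <[s]> r.
Proof.
have [sub | /subsetPn[u uS us]] := boolP (S \subset <[s]>%g).
  by exists [::]; apply/coset_path_nil/gen_full.
have [r r_path] := coset_path_exists (inner_path_cycle s) uS us.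
by exists [:: u, u & r].
Qed.

End CosetPaths.

(** * Constructions of Hamiltonian words *)

Section HamWords.
Local Open Scope ring_scope.
Variables (Gamma : finZmodType) (S : {set Gamma}).
Hypothesis S_gen : <<S>>%g = [set: Gamma].
Hypothesis n_odd : odd #|Gamma|.
Hypothesis oppS : forall x, (- x \in S) = (x \in S).
Hypothesis S_0 : 0 \notin S.
Implicit Types (s t u v x a b : Gamma) (w ts : seq Gamma).

Lemma order_gt2 s : s \in S -> (2 < #[s]%g)%N.
Proof.
move=> sS; have := odd_card_group n_odd <[s]>%G; rewrite -[#|_|]/#[s]%g.
have: #[s]%g != 1%N by rewrite order_eq1; apply: contraNneq S_0 => s1; rewrite s1 in sS.
by have := order_gt0 s; case: #[s]%g => [|[|[]]].
Qed.

Lemma order_neq4 s : #[s]%g != 4%N.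
Proof.
by have := odd_card_group n_odd <[s]>%G; rewrite -[#|_|]/#[s]%g; case: eqP => // ->.
Qed.

Definition run s := nseq (#[s]%g - 1) s.

Lemma run_sub s : s \in S -> {subset run s <= S}.
Proof. by move=> sS x; rewrite mem_nseq => /andP[_ /eqP->]. Qed.

Lemma word_sum_run s : s \in S -> word_sum (run s) = - s.
Proof.
move=> /order_gt2 s_gt2; rewrite word_sum_nseq -[LHS]opprK -mulNrn.
by rewrite (mulrn_opp_order (j := 1)) // subnK // ltnW // ltnW.
Qed.

Lemma mem_run s v : v \in <[s]>%g -> v \in 0 :: scanl +%R 0 (run s).
Proof.
case/mem_cycle_mulrn => [[|i] lt_i ->]; first by rewrite mem_head.
by rewrite in_cons mem_scanl_nseq ?orbT //; exists i.+1; rewrite ?add0r //; lia.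
Qed.

Lemma ham_word_run s r R :
    s \in S -> is_coset_path S s <[s]> r -> is_cap S s r R ->
  ham_word S (run s ++ R).
Proof.
move=> sS r_path R_cap; have s_gt2 := order_gt2 sS.
apply: ham_word_cap r_path R_cap _ _ _ _; rewrite ?cycle_id //.
- exact: run_sub.
- exact: word_sum_run.
- by rewrite size_nseq -[#|_|]/#[s]%g; lia.
- exact: mem_run.
Qed.

(* Moving one step -s from one side of the inner cap to the other (k = 0 versus
   k = 1) changes only few windows of the word. *)
Lemma ham_word_zigzag s t : s \in S -> t \in S -> t \notin <[s]>%g ->
  exists J, forall k, (k + 2 <= #[s]%g)%N ->
    ham_word S (run s ++ t :: nseq (#[s]%g - 2 - k) (- s) ++
                t :: J ++ [:: s, - t & rcons (nseq k (- s)) (- t)]).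
Proof.
move=> sS tS ts; have s_gt2 := order_gt2 sS.
have [r r_path] := coset_path_exists S_gen n_odd (inner_path_cycle S s) tS ts.
(* [J] is the inner cap without its first letter [t] and its last two letters [s], [- t]. *)
exists (nseq (#[- s]%g - 2 - 1) (- - s) ++ cap (- - s) r) => k le_k.
have -> : t :: nseq (#[s]%g - 2 - k) (- s) ++
    t :: (nseq (#[- s]%g - 2 - 1) (- - s) ++ cap (- - s) r) ++
     [:: s, - t & rcons (nseq k (- s)) (- t)]
   = cap_level s k t (cap (- s) (t :: r)).
  by rewrite /cap_level /= /cap_level /= !opprK -!catA.
apply: (ham_word_run sS r_path); apply: is_cap_level => //.
have [rS _ _] := r_path; apply: is_cap_cap; rewrite ?oppS ?order_opp //.
move=> x x_in; have : x \in S :\: <[s]>%g by rewrite rS // in_cons x_in orbT.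
by case/setDP.
Qed.

Lemma ham_word_base s : s \in S ->
  exists r, is_coset_path S s <[s]> r /\ is_cap S s r (cap s r).
Proof.
move=> sS; have [r r_path] := coset_path_cycle S_gen n_odd s.
exists r; split=> //; have [rS _ _] := r_path.
by apply: is_cap_cap; rewrite ?order_gt2 // => x /rS /setDP[].
Qed.

(* Inside the first level, the Hamiltonian cycle 0, a, 2a, ... of <[a]> is replaced
   by the one using the two chords j a. *)
Lemma ham_word_flip a j r R :
    a \in S -> a *+ j \in S -> (1 < j)%N -> (j + 1 < #[a]%g)%N ->
    is_coset_path S (- a) <[- a]> r -> is_cap S (- a) r R ->
  ham_word S (nseq (j - 2) (- a) ++ a *+ j ::
              nseq (#[a]%g - j - 1) a ++ a *+ j :: R).
Proof.
move=> aS jS j_gt1 lt_j r_path R_cap.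
rewrite -[X in nseq (j - 2) _ ++ X]cat1s.
rewrite -[_ *+ j :: R]cat1s !catA; apply: ham_word_cap r_path R_cap _ _ _ _.
- by rewrite cycle_id.
- move=> x; rewrite !mem_cat !inE !mem_nseq.
  by case/orP=> [/orP[/orP[/andP[_ /eqP->]|/eqP->]|/andP[_ /eqP->]]|/eqP->];
    rewrite ?oppS.
- rewrite !word_sumE !addr0 opprK -[RHS]mulr1n.
  rewrite (mulrn_opp_order (j := #[a]%g - j + 2)) -?mulrnDr; last lia.
  have -> : (#[a]%g - j + 2 + j + (#[a]%g - j - 1) + j = #[a]%g + #[a]%g + 1)%N by lia.
  by rewrite !mulrnDr mulrn_order !add0r.
- rewrite !size_cat !size_nseq /= -[#|_|]/#[- a]%g order_opp; lia.
(* The path descends from 0 to [-(j - 2) a], jumps to [2 a], climbs to [(#[a] - j + 1) a] and jumps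
   to [a]. *)
move=> v v_in; have: v \in <[a]>%g by rewrite -cycle_opp.
case/mem_cycle_mulrn=> {v v_in} i lt_i ->.
have [->|i_gt0] := posnP i; first by rewrite mem_head.
rewrite in_cons !mem_scanl_cat !word_sumE !add0r.
have head_sum : (- a) *+ (j - 2) + (a *+ j + 0) = a *+ 2.
  rewrite addr0 (mulrn_opp_order (j := #[a]%g - j + 2)) -?mulrnDr; last lia.
  have -> : (#[a]%g - j + 2 + j = #[a]%g + 2)%N by lia.
  by rewrite mulrnDr mulrn_order add0r.
have [le_i|gt_i] := leqP i (#[a]%g - j + 1).
  have [i1|i_neq1] := eqVneq i 1%N.
    rewrite i1 /= !inE head_sum -!mulrnDr.
    have -> : (2 + (#[a]%g - j - 1) + j = #[a]%g + 1)%N by lia.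
    by rewrite mulrnDr mulrn_order add0r eqxx !orbT.
  have [i2|i_neq2] := eqVneq i 2%N.
    by rewrite i2 -head_sum addr0 /= !inE eqxx !orbT.
  rewrite [_ \in scanl _ _ (nseq (_ - _ - 1) a)]mem_scanl_nseq ?orbT //.
  by exists (i - 2)%N; [lia | rewrite head_sum -mulrnDr; congr (_ *+ _); lia].
rewrite [_ \in scanl _ _ (nseq (j - 2) _)]mem_scanl_nseq ?orbT //.
exists (#[a]%g - i)%N; first lia.
by rewrite add0r (mulrn_opp_order (j := i)) //; lia.
Qed.

End HamWords.

(** The window relations are linear in the indicators, and of an indicator only the bound by 1 is
    used. *)
Ltac lia_bool :=
  repeat match goal with |- context [nat_of_bool ?b] =>
    move: (leq_b1 b); move: (nat_of_bool b)
  end; clear; lia.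

(** * Relations between indicators obtained by comparing window counts *)

Section Invariance.
Local Open Scope ring_scope.
Variables (Gamma : finZmodType) (S : {set Gamma}).
Hypothesis S_gen : <<S>>%g = [set: Gamma].
Hypothesis n_odd : odd #|Gamma|.
Hypothesis oppS : forall x, (- x \in S) = (x \in S).
Hypothesis S_0 : 0 \notin S.
Hypothesis nwin_inv : forall k w1 w2,
  ham_word S w1 -> ham_word S w2 -> nwin S k w1 = nwin S k w2.
Implicit Types (s t u v x a b : Gamma) (w ts : seq Gamma).

Lemma oppSB x y : (x - y \in S) = (y - x \in S).
Proof. by rewrite -oppS opprB. Qed.

Lemma oppSD x y : (- x - y \in S) = (x + y \in S).
Proof. by rewrite -opprD oppS. Qed.

Local Notation ind x := (nat_of_bool (x%R \in S)).

(** From [k = 0] to [k = 1] the word loses one window [- s, - s] and the window [- t, - t], and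
    gains [- t, - s] and [- s, - t]. *)
Lemma zigzag_windows2 s t :
    s \in S -> t \in S -> t \notin <[s]>%g -> (4 < #[s]%g)%N ->
  (ind (s + s) + ind (t + t) = ind (s + t) + ind (s + t))%N.
Proof.
move=> sS tS ts s_gt4.
have [J J_ham] := ham_word_zigzag S_gen n_odd oppS S_0 sS tS ts.
have s_gt2 := ltnW (ltnW s_gt4).
have := nwin_inv 2 (J_ham 0%N (ltnW s_gt2)) (J_ham 1%N s_gt2).
rewrite /run; have [m ->] : exists m, #[s]%g = m.+4.+1.
  by exists (#[s]%g - 5)%N; lia.
rewrite !subSS !subn0 /= !nwin2E /= !rcons_cat /= !rcons_cat /= -!cats1 -!catA /=.
rewrite !nwin2_cat /= !nwin2_cat /= !oppSD [t + s]addrC; lia_bool.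
Qed.

(** For [k = 1] no step [- s] is left before the inner cap: [t, - s] and [- s, t] give way to
    [t, t], which balances the loss of [- t, - t], while [- t, - s] and [- s, - t] are gained. *)
Lemma zigzag_windows2_order3 s t :
    s \in S -> t \in S -> t \notin <[s]>%g -> #[s]%g = 3%N ->
  (s + t \in S) = (t - s \in S).
Proof.
move=> sS tS ts s_3.
have [J J_ham] := ham_word_zigzag S_gen n_odd oppS S_0 sS tS ts.
have := nwin_inv 2 (J_ham 0%N _) (J_ham 1%N _).
rewrite /run s_3 /= !nwin2E /= !rcons_cat /=.
move=> /(_ isT isT); rewrite !nwin2_cat /= !oppSD [t + s]addrC.
rewrite (oppSB s) [- s + t]addrC => eq_count.
have: ind (s + t) = ind (t - s) by move: eq_count; lia_bool.
by do 2!case: (_ \in S).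
Qed.

(** The constant 2 comes from the windows [s, - t, - s] and [- s, - t, s] for [k = 1], whose sum
    [- t] lies in [S]. *)
Lemma zigzag_windows3 s t :
    (forall a b, a \in S -> b \in S -> a + b \notin S) ->
    s \in S -> t \in S -> t \notin <[s]>%g -> (4 < #[s]%g)%N ->
  (ind (s + s + s) + ind (s - t - t) + ind (s - t - t) = 2 + ind (s + t + t))%N.
Proof.
move=> sum_free sS tS ts s_gt4.
have [J J_ham] := ham_word_zigzag S_gen n_odd oppS S_0 sS tS ts.
have s_gt2 := ltnW (ltnW s_gt4).
have := nwin_inv 3 (J_ham 0%N (ltnW s_gt2)) (J_ham 1%N s_gt2).
rewrite /run; have [m ->] : exists m, #[s]%g = m.+4.+1.
  by exists (#[s]%g - 5)%N; lia.
rewrite !subSS !subn0 /= !nwin3E /= -!catA /= -!catA /=.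
have split_J X : nseq m (- s) ++ t :: (J ++ X) ++ [:: s; s]
    = (nseq m (- s) ++ t :: J) ++ X ++ [:: s; s] by rewrite -!catA.
rewrite !split_J !nwin3_cat /= !nwin3_cat /=.
have -> : - s - s - s = - (s + s + s) by rewrite !opprD.
have -> : - t - t + s = s - t - t by rewrite addrC addrA.
have -> : s - t - s = - t by rewrite addrAC subrr add0r.
have -> : - t - s - t = - (s + t + t) by rewrite !opprD [- t - s]addrC.
have -> : - s - t + s = - t by rewrite addrAC addNr add0r.
by rewrite !oppS tS /=; lia_bool.
Qed.

Definition sum_closed := forall a b, a \in S -> b \in S -> a + b != 0 -> a + b \in S.

(** Consecutive letters of a cap are equal or belong to different generators at neighbouring levels.
    The final [s] is the letter that follows the cap: a step of the level below or the start of the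
    word. *)
Lemma cap_windows2 (P : rel Gamma) s ts :
    (4 < #[s]%g)%N ->
    (forall a b, a \in [:: s; - s] -> b \in [:: a] ++ ts ++ [seq - x | x <- ts] ->
       P a b /\ P b a) ->
  path P s (rcons (cap s ts) s).
Proof.
elim: ts s => [|t ts IHts] s s_gt4 P_s /=.
  by have [//||->] := P_s s s; rewrite ?mem_head //.
have P_st a b : a \in [:: s; - s] -> b \in [:: t; - t] -> P a b /\ P b a.
  move=> a_in b_in; apply: P_s => //; rewrite !mem_cat /= !inE.
  by move: b_in; rewrite !inE => /orP[] ->; rewrite !orbT.
have P_ss a : a \in [:: s; - s] -> P a a.
  by move=> a_in; have [||->] := P_s a a; rewrite ?mem_head.
have Ns_in : - s \in [:: s; - s] by rewrite !inE eqxx orbT.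
have s_in : s \in [:: s; - s] by rewrite mem_head.
have t_in : t \in [:: t; - t] by rewrite mem_head.
have Nt_in : - t \in [:: t; - t] by rewrite !inE eqxx orbT.
have run_path k x : P x (- s) -> path P x (nseq k (- s)).
  by elim: k x => //= k IHk x -> /=; apply: IHk; apply: P_ss.
rewrite /cap_level -cats1 /= (proj1 (P_st _ _ s_in t_in)) /= -!catA cat_path.
rewrite (run_path _ _ (proj2 (P_st _ _ Ns_in t_in))) /=.
have -> : last t (nseq (#[s]%g - 2 - 1) (- s)) = - s.
  by have -> : (#[s]%g - 2 - 1 = (#[s]%g - 4).+1)%N; [lia | elim: (_ - 4)%N].
rewrite -cat_rcons cat_path IHts ?order_opp //=.
  rewrite last_rcons (proj1 (P_st _ _ Ns_in Nt_in)) /=.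
  by rewrite (proj2 (P_st _ _ s_in Nt_in)).
move=> a b a_in b_in; apply: P_s.
  by rewrite opprK !inE orbC in a_in *.
move: b_in; rewrite map_cons !(mem_cat, inE) => /orP[->|/orP[]->] //.
  by rewrite !orbT.
by rewrite !orbT.
Qed.

Lemma windows2_const s :
    s \in S -> (4 < #[s]%g)%N ->
  exists c : bool, forall w, ham_word S w -> nwin S 2 w = (c * size w)%N.
Proof.
move=> sS s_gt4; exists (s + s \in S).
suff [w w_ham w_count] : exists2 w,
    ham_word S w & nwin S 2 w = (ind (s + s) * size w)%N.
  move=> w' w'_ham; rewrite (nwin_inv 2 w'_ham w_ham) w_count.
  by case: w_ham w'_ham => _ _ -> _ [_ _ -> _].
have [r [r_path r_cap]] := ham_word_base S_gen n_odd oppS S_0 sS.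
have r_ham := ham_word_run n_odd S_0 sS r_path r_cap.
exists (run s ++ cap s r) => //.
pose P : rel Gamma := fun a b => (a + b \in S) == (s + s \in S).
have nwin2_path x w : path P x w -> nwin2 S x w = (ind (s + s) * size w)%N.
  by elim: w x => [|y w IHw] x /=; rewrite ?muln0 // mulnS => /andP[/eqP-> /IHw->].
have s_gt2 := order_gt2 n_odd S_0 sS.
have run_path : path P s (nseq (#[s]%g - 2) s).
  by elim: (_ - 2)%N => //= k ->; rewrite /P eqxx.
have -> : run s = s :: nseq (#[s]%g - 2) s.
  by rewrite /run; have -> : (#[s]%g - 1 = (#[s]%g - 2).+1)%N by lia.
rewrite /= nwin2E rcons_cat nwin2_path.
  by rewrite !size_cat size_rcons /= addnS.
rewrite cat_path run_path /=.
have -> : last s (nseq (#[s]%g - 2) s) = s by elim: (_ - 2)%N.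
have [rS _ _] := r_path.
have P_sym x y : P x y -> P x y /\ P y x by rewrite /P [y + x]addrC.
have P_opp x y : P (- x) y = P x (- y) by rewrite /P -oppS opprD opprK.
have P_st t : t \in S -> t \notin <[s]>%g -> P s t.
  move=> tS ts; rewrite /P.
  (* Indicators being 0 or 1, the relation forces those of [s + s] and [s + t] to agree. *)
  have eq1 := zigzag_windows2 sS tS ts s_gt4.
  by move: eq1; do 3!case: (_ \in S).
apply: cap_windows2 => // a b a_in; rewrite mem_cat mem_seq1 => /orP[/eqP->|b_in].
  apply: P_sym; move: a_in; rewrite !inE => /orP[]/eqP->; first exact: eqxx.
  by rewrite P_opp opprK; apply: eqxx.
have [bS bs] : b \in S /\ b \notin <[s]>%g.
  move: b_in; rewrite mem_cat => /orP[/rS/setDP[]//|/mapP[x /rS/setDP[xS xs] ->]].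
  by rewrite oppS mem_groupN.
apply: P_sym; move: a_in; rewrite !inE => /orP[]/eqP->; first exact: P_st.
by rewrite P_opp; apply: P_st; rewrite ?oppS ?mem_groupN.
Qed.

(** If [b] is outside [<[a]>], the pair occurs where [run a] climbs to the first level; if
    [b = a *+ j], at the second chord of [ham_word_flip], or inside [run a] when [j = 1]. *)
Lemma ham_word_two_steps a b :
    a \in S -> b \in S -> a + b != 0 ->
  exists u v : seq Gamma, ham_word S (u ++ [:: a; b] ++ v).
Proof.
move=> aS bS ab; have a_gt2 := order_gt2 n_odd S_0 aS.
have [|ba] := boolP (b \in <[a]>%g); last first.
  have [J J_ham] := ham_word_zigzag S_gen n_odd oppS S_0 aS bS ba.
  exists (nseq (#[a]%g - 2) a); eexists.
  have := J_ham 0%N (ltnW a_gt2); rewrite /run.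
  have -> : nseq (#[a]%g - 1) a = nseq (#[a]%g - 2) a ++ [:: a].
    by rewrite -[[:: a]]/(nseq 1 a) -nseqD; congr nseq; lia.
  by rewrite -catA /=; apply.
case/mem_cycle_mulrn=> j lt_j b_def.
have [r [r_path r_cap]] := ham_word_base S_gen n_odd oppS S_0 aS.
have j_gt0 : (0 < j)%N.
  by rewrite lt0n; apply: contraNneq S_0 => j0; rewrite -(mulr0n a) -j0 -b_def.
have [j1|j_neq1] := eqVneq j 1%N.
  exists [::], (nseq (#[a]%g - 3) a ++ cap a r).
  have := ham_word_run n_odd S_0 aS r_path r_cap.
  by have -> : run a = [:: a, a & nseq (#[a]%g - 3) a];
     rewrite ?b_def ?j1 // /run; have -> : (#[a]%g - 1 = (#[a]%g - 3).+2)%N by lia.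
have lt_j1 : (j + 1 < #[a]%g)%N.
  rewrite ltn_neqAle addn1 lt_j andbT; apply: contraNneq ab => j_max.
  by rewrite b_def -mulrS j_max mulrn_order.
have NaS : - a \in S by rewrite oppS.
have [r' [r'_path r'_cap]] := ham_word_base S_gen n_odd oppS S_0 NaS.
have jS : a *+ j \in S by rewrite -b_def.
have := ham_word_flip n_odd oppS S_0 aS jS _ lt_j1 r'_path r'_cap.
have -> : nseq (#[a]%g - j - 1) a = nseq (#[a]%g - j - 2) a ++ [:: a].
  by rewrite -[[:: a]]/(nseq 1 a) -nseqD; congr nseq; lia.
rewrite -b_def -!catA /= => w_ham.
exists (rcons (nseq (j - 2) (- a)) b ++ nseq (#[a]%g - j - 2) a), (cap (- a) r').
rewrite -cats1 -!catA; apply: w_ham; lia.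
Qed.

End Invariance.

(** * Sum-closed and sum-free connection sets *)

Section Cases.
Local Open Scope ring_scope.
Variables (Gamma : finZmodType) (S : {set Gamma}).
Hypothesis S_gen : <<S>>%g = [set: Gamma].
Hypothesis n_odd : odd #|Gamma|.
Hypothesis oppS : forall x, (- x \in S) = (x \in S).
Hypothesis S_0 : 0 \notin S.
Hypothesis nwin_inv : forall k w1 w2,
  ham_word S w1 -> ham_word S w2 -> nwin S k w1 = nwin S k w2.
Implicit Types (s t x a b : Gamma) (w ts : seq Gamma).

Local Notation ind x := (nat_of_bool (x%R \in S)).

Lemma sum_closed_or_free s :
    s \in S -> (4 < #[s]%g)%N ->
  sum_closed S \/ (forall a b, a \in S -> b \in S -> a + b \notin S).
Proof.
move=> sS s_gt4.
have [c c_count] := windows2_const S_gen n_odd oppS S_0 nwin_inv sS s_gt4.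
have c_sum a b : a \in S -> b \in S -> a + b != 0 -> (a + b \in S) = c.
  move=> aS bS ab.
  have [u [v uv_ham]] := ham_word_two_steps S_gen n_odd oppS S_0 aS bS ab.
  have := nwin_full (c_count _ uv_ham) (erefl _) (erefl _) (isT : [:: a; b] != [::]).
  by rewrite !word_sumE addr0.
case: c c_sum {c_count} => c_sum; [left | right] => a b aS bS.
  by move=> ab; rewrite c_sum.
have [->|ab] := eqVneq (a + b) 0; first exact: S_0.
by rewrite c_sum.
Qed.

Section SumFree.
Hypothesis sum_free : forall a b, a \in S -> b \in S -> a + b \notin S.

Lemma sum_free_order s : s \in S -> (4 < #[s]%g)%N.
Proof.
move=> sS; have := order_gt2 n_odd S_0 sS; have := order_neq4 n_odd s.
have: #[s]%g != 3%N; last by case: #[s]%g => [|[|[|[|[]]]]].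
apply: contraTneq (sum_free sS sS) => s3; rewrite negbK.
have -> : s + s = - s by apply/eqP; rewrite -addr_eq0 -mulr2n -mulrSr -s3 mulrn_order.
by rewrite oppS.
Qed.

(** The relation is used for [t] and for [- t]: if [s + t + t] were not in [S], the second instance
    would make the single indicator of [s + s + s] at least 2. *)
Lemma sum_free_add_double s t :
  s \in S -> t \in S -> t \notin <[s]>%g -> s + t + t \in S.
Proof.
move=> sS tS ts; have s_gt4 := sum_free_order sS.
have eq1 := zigzag_windows3 S_gen n_odd oppS S_0 nwin_inv sum_free sS tS ts s_gt4.
have := @zigzag_windows3 _ S S_gen n_odd oppS S_0 nwin_inv s (- t) sum_free sS.
rewrite oppS mem_groupN opprK => /(_ tS ts s_gt4); move: eq1.
by case: (s + t + t \in S) => //=; lia_bool.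
Qed.

Lemma sum_free_generator s : s \in S -> exists2 t, t \in S & <[t]>%g = [set: Gamma].
Proof.
move=> sS; have [/exists_inP[t tS /eqP t_gen]|] :=
  boolP [exists t in S, <[t]>%g == [set: Gamma]]; first by exists t.
rewrite negb_exists_in => /forall_inP no_gen; exfalso.
have [s1 s1S s1_max] : exists2 s1,
    s1 \in S & forall x, x \in S -> (#[x]%g <= #[s1]%g)%N.
  by case: (arg_maxnP (fun x => #[x]%g) sS) => s1 s1S s1_max; exists s1.
have [sub|/subsetPn[t tS ts]] := boolP (S \subset <[s1]>%g).
  have := gen_full S_gen sub.
  by move/(congr1 val)/eqP => /= eq_s1; have := no_gen _ s1S; rewrite eq_s1.
have s1x x : x \in S -> x \notin <[s1]>%g -> s1 \notin <[x]>%g.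
  move=> xS; apply: contra => s1x; suff -> : <[s1]>%g = <[x]>%g by apply: cycle_id.
  by apply/eqP; rewrite eqEcard cycle_subG s1x; apply: s1_max.
have ts1 k : t + s1 *+ k.*2 \in S.
  elim: k => [|k IHk]; first by rewrite addr0.
  rewrite doubleS !mulrSr !addrA; apply: sum_free_add_double => //.
  by apply: s1x; rewrite // mem_groupDr // mulrn_mem_cycle.
(* The order of [s1] is odd, so [s1] equals its even multiple [(#[s1] + 1) s1], and [t + s1] would
   lie in [S]. *)
have := sum_free tS s1S; rewrite -[s1]mulr1n -[s1 *+ 1]add0r -(mulrn_order s1) -mulrnDr.
have := odd_card_group n_odd <[s1]>%G; rewrite -[#|_|]/#[s1]%g addn1 => s1_odd.
by rewrite -[X in s1 *+ X]odd_double_half /= s1_odd ts1.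
Qed.

Lemma sum_free_sign s t :
  s \in S -> <[s]>%g = [set: Gamma] -> t \in S -> (t == s) || (t == - s).
Proof.
move=> sS s_gen tS; have s_gt4 := sum_free_order sS.
have s_card : #[s]%g = #|Gamma| by rewrite /order s_gen cardsT.
have s_setT : <[s]>%G = [set: Gamma]%G by apply/val_inj.
(* As [s] generates [Gamma], there are no cosets to sweep: coset paths are empty and caps are single
   edges. *)
have gen_path x : <[x]>%G = <[s]>%G -> is_coset_path S x <[x]> [::].
  by move=> ->; apply: coset_path_nil.
have s_ham : ham_word S (run s ++ [:: s]).
  by apply: ham_word_run (gen_path s _) (is_cap_nil _).
(* All 3-windows of the constant word [s, ..., s] have sum [3 s], so its count is 0 or full. *)
have [c c_count] : exists c : bool,
    forall w, ham_word S w -> nwin S 3 w = (c * size w)%N.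
  exists (s + s + s \in S) => w w_ham; rewrite (nwin_inv 3 w_ham s_ham).
  have -> : size w = size (run s ++ [:: s]).
    by case: s_ham w_ham => _ _ -> _ [_ _ -> _].
  apply: nwin_const => i; congr (_ \in S).
  have -> : run s ++ [:: s] = nseq #[s]%g s.
    by rewrite /run -[[:: s]]/(nseq 1 s) -nseqD; congr nseq; lia.
  rewrite /window !big_ord_recl big_ord0 addr0 /= !nth_nseq size_nseq.
  by rewrite !ltn_mod order_gt0 addrA.
have flip_ham j : s *+ j \in S -> (1 < j)%N -> (j + 1 < #[s]%g)%N ->
    ham_word S (nseq (j - 2) (- s) ++ s *+ j ::
                nseq (#[s]%g - j - 1) s ++ s *+ j :: [:: - s]).
  move=> jS j_gt1 lt_j.
  apply: ham_word_flip (gen_path (- s) _) (is_cap_nil _) => //; rewrite ?oppS //.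
  by apply/val_inj; rewrite /= cycle_opp.
have nseq_last k : (0 < k)%N -> nseq k s = nseq (k - 1) s ++ [:: s].
  by move=> k_gt0; rewrite -[[:: s]]/(nseq 1 s) -nseqD subnK.
have [j lt_j t_def] : exists2 j, (j < #[s]%g)%N & t = s *+ j.
  by apply: mem_cycle_mulrn; rewrite s_gen in_setT.
apply/contraT; rewrite negb_or => /andP[t_neq_s t_neq_Ns].
have m_odd : odd #[s]%g by rewrite s_card.
have j_gt1 : (1 < j)%N.
  case: j t_def {lt_j} => [|[|//]] t_def; last by rewrite t_def eqxx in t_neq_s.
  by rewrite t_def (negbTE S_0) in tS.
have lt_j1 : (j + 1 < #[s]%g)%N.
  rewrite ltn_neqAle addn1 lt_j andbT; apply: contraNneq t_neq_Ns => j_max.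
  by rewrite t_def -addr_eq0 -mulrSr j_max mulrn_order.
(* The window s, t, -s occurs, and its sum t lies in S. *)
have c1 : c.
  have jS : s *+ j \in S by rewrite -t_def.
  have run_gt0 : (0 < #[s]%g - j - 1)%N by lia.
  rewrite -(nwin_full (S := S) (k := 3) (z := [:: s; s *+ j; - s]) (v := [::])
    (u := nseq (j - 2) (- s) ++ s *+ j :: nseq (#[s]%g - j - 1 - 1) s)
    (c_count _ (flip_ham j jS j_gt1 lt_j1))) //.
    by rewrite !word_sumE addr0 addrC subrK.
  by rewrite (nseq_last _ run_gt0) -!catA.
(* The window [s, s, i s] occurs at the second chord of the flipped word. *)
have add2 i : s *+ i \in S -> (1 < i)%N -> (i + 2 < #[s]%g)%N -> s *+ (i + 2) \in S.
  move=> iS i_gt1 lt_i2; have lt_i1 : (i + 1 < #[s]%g)%N by lia.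
  have run_gt0 : (0 < #[s]%g - i - 1)%N by lia.
  have run_gt1 : (0 < #[s]%g - i - 1 - 1)%N by lia.
  have := nwin_full (S := S) (k := 3) (z := [:: s; s; s *+ i]) (v := [:: - s])
    (u := nseq (i - 2) (- s) ++ s *+ i :: nseq (#[s]%g - i - 1 - 1 - 1) s)
    (c_count _ (flip_ham i iS i_gt1 lt_i1)).
  rewrite !word_sumE addr0 c1 addrA [_ + s *+ i]addrC -mulr2n -mulrnDr; apply=> //.
  by rewrite (nseq_last _ run_gt0) (nseq_last _ run_gt1) -!catA.
have odd_mult i : (i.*2 + 3 < #[s]%g)%N -> s *+ (i.*2 + 3) \in S.
  elim: i => [|i IHi] lt_i; last first.
    have -> : (i.+1.*2 + 3 = i.*2 + 3 + 2)%N by lia.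
    by apply: add2; [apply: IHi | | ]; lia.
  have := nwin_full (S := S) (k := 3) (z := [:: s; s; s]) (c_count _ s_ham) (u := [::])
    (v := nseq (#[s]%g - 3) s).
  rewrite !word_sumE c1 addr0 addrA -mulr2n -mulrSr; apply=> //.
  by rewrite -[[:: s; s; s]]/(nseq 3 s) -[[:: s]]/(nseq 1 s) -!nseqD; congr nseq; lia.
(* The order being odd, [- 2 s] is the odd multiple [(#[s] - 2) s], which [odd_mult] puts in [S]. *)
have := sum_free sS sS; rewrite -oppS -mulr2n -mulNrn.
rewrite (mulrn_opp_order (j := #[s]%g - 2)); last lia.
have [i mE] : exists i, (#[s]%g - 2 = i.*2 + 3)%N.
  exists ((#[s]%g - 5)./2)%N; have := odd_double_half (#[s]%g - 5).
  by rewrite oddB // m_odd /=; lia.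
by rewrite mE odd_mult // -mE; lia.
Qed.

End SumFree.
End Cases.

(** * Connection sets whose elements all have order 3 *)

Section Order3.
Local Open Scope ring_scope.
Variables (Gamma : finZmodType) (S : {set Gamma}).
Hypothesis S_gen : <<S>>%g = [set: Gamma].
Hypothesis n_odd : odd #|Gamma|.
Hypothesis oppS : forall x, (- x \in S) = (x \in S).
Hypothesis S_0 : 0 \notin S.
Hypothesis nwin_inv : forall k w1 w2,
  ham_word S w1 -> ham_word S w2 -> nwin S k w1 = nwin S k w2.
Implicit Types (s t u x a b : Gamma) (w ts : seq Gamma).

Local Notation ind x := (nat_of_bool (x%R \in S)).

(* Two Hamiltonian paths from 0 to - s in the group generated by s and t when both
   have order 3. *)
Definition helix s t := [:: s; t; s; s; t; s; s; t].
Definition snake s t := [:: s; t; - s; t; s; s; - t; - t].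

Lemma order3_double s : #[s]%g = 3%N -> s + s = - s.
Proof.
by move=> s3; apply/eqP; rewrite -addr_eq0 -mulr2n -mulrSr -s3 mulrn_order.
Qed.

Section Plane.
Variables s t : Gamma.
Hypotheses (sS : s \in S) (tS : t \in S) (ts : t \notin <[s]>%g).
Hypotheses (s3 : #[s]%g = 3%N) (t3 : #[t]%g = 3%N).

Let plane : {group Gamma} := (<[s]> <*> <[t]>)%G.

Lemma plane_mem v :
  v \in plane -> exists i j, [/\ (i < 3)%N, (j < 3)%N & v = s *+ i + t *+ j].
Proof.
rewrite /plane /= cent_joinEr; last first.
  by apply/centsP => x _ y _; apply: (zmod_mulgC x).
case/mulsgP => x y /mem_cycle_mulrn[i lt_i ->] /mem_cycle_mulrn[j lt_j ->] ->.
by exists i, j; rewrite -{1}s3 -{1}t3.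
Qed.

Lemma card_plane : #|plane| = 9%N.
Proof.
rewrite /plane /= cent_joinEr; last first.
  by apply/centsP => x _ y _; apply: (zmod_mulgC x).
rewrite TI_cardMg; first by rewrite -![#|_|]/(#[_]%g) s3 t3.
by rewrite setIC; apply: prime_TIg; rewrite ?cycle_subG // -[#|_|]/#[t]%g t3.
Qed.

Lemma mem_plane_s : s \in plane.
Proof. exact/(subsetP (joing_subl _ _))/cycle_id. Qed.

Lemma mem_plane_t : t \in plane.
Proof. exact/(subsetP (joing_subr _ _))/cycle_id. Qed.

Lemma plane_path : is_inner_path S s plane [:: t; t].
Proof.
split; rewrite ?card_plane ?s3 //.
- exact: mem_plane_s.
- by move=> x; rewrite !inE orbb => /eqP->; rewrite ts tS.
- by move=> x; rewrite !inE orbb => /eqP->; apply: mem_plane_t.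
move=> v /plane_mem[i [j [_ lt_j ->]]]; exists (t *+ j).
  by case: j lt_j => [|[|[]]] //= _; rewrite !inE !add0r ?mulr2n eqxx ?orbT.
by rewrite addrK mulrn_mem_cycle.
Qed.

Let coord (p : nat * nat) := s *+ p.1 + t *+ p.2.
Let addp (p q : nat * nat) := ((p.1 + q.1)%N, (p.2 + q.2)%N).
Let origin := (0%N, 0%N).

(** In coordinates modulo 3, covering the plane becomes a finite computation on pairs. *)
Lemma plane_cover (ww : seq (nat * nat)) :
    all (fun p => p \in [seq ((q.1 %% 3)%N, (q.2 %% 3)%N)
                        | q <- origin :: scanl addp origin ww])
        (allpairs pair (iota 0 3) (iota 0 3)) ->
  forall v, v \in plane -> v \in 0 :: scanl +%R 0 (map coord ww).
Proof.
move=> /allP cover v /plane_mem[i [j [lt_i lt_j ->]]].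
have coordD p q : coord (addp p q) = coord p + coord q.
  by rewrite /coord /addp /= !mulrnDr addrACA.
have coord_mod p : coord ((p.1 %% 3)%N, (p.2 %% 3)%N) = coord p.
  have mod3 x k : #[x]%g = 3%N -> x *+ (k %% 3) = x *+ k.
    by move=> x3; rewrite -x3 -!zmodXgE expg_mod_order.
  by rewrite /coord /= !mod3.
have -> : 0 :: scanl +%R 0 (map coord ww) = map coord (origin :: scanl addp origin ww).
  have -> : 0 = coord origin by rewrite /coord /= addr0.
  rewrite /=; congr (_ :: _); elim: ww origin {cover} => //= p ww IHww q.
  by rewrite -coordD IHww.
have ij_in : (i, j) \in allpairs pair (iota 0 3) (iota 0 3).
  by apply: allpairs_f; rewrite mem_iota.
have /mapP[q q_in [-> ->]] := cover _ ij_in.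
by rewrite -[_ + _]/(coord (_, _)) coord_mod map_f.
Qed.

Let opp_coord p : coord ((2 * p.1)%N, (2 * p.2)%N) = - coord p.
Proof.
by rewrite /coord /= !mulrnA !mulr2n (order3_double s3) (order3_double t3) !mulNrn opprD.
Qed.

Let s_coord : s = coord (1%N, 0%N). Proof. by rewrite /coord addr0. Qed.
Let t_coord : t = coord (0%N, 1%N). Proof. by rewrite /coord add0r. Qed.

Lemma helix_cover v : v \in plane -> v \in 0 :: scanl +%R 0 (helix s t).
Proof.
have -> : helix s t = map coord
    [:: (1, 0); (0, 1); (1, 0); (1, 0); (0, 1); (1, 0); (1, 0); (0, 1)]%N.
  by rewrite /= -s_coord -t_coord.
exact: plane_cover.
Qed.

Lemma snake_cover v : v \in plane -> v \in 0 :: scanl +%R 0 (snake s t).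
Proof.
have -> : snake s t = map coord
    [:: (1, 0); (0, 1); (2, 0); (0, 1); (1, 0); (1, 0); (0, 2); (0, 2)]%N.
  have Ns : - s = coord (2, 0)%N by rewrite {1}s_coord -opp_coord.
  have Nt : - t = coord (0, 2)%N by rewrite {1}t_coord -opp_coord.
  by rewrite /snake Ns Nt /= -s_coord -t_coord.
exact: plane_cover.
Qed.

Lemma word_sum_helix : word_sum (helix s t) = - s.
Proof.
have ss := order3_double s3; have tt := order3_double t3.
rewrite !word_sumE addr0 [s + (s + t)]addrA ss [t + (- s + t)]addrCA tt.
by rewrite addNKr [t + _]addrCA subrr addr0.
Qed.

Lemma word_sum_snake : word_sum (snake s t) = - s.
Proof.
have ss := order3_double s3; have tt := order3_double t3.
rewrite !word_sumE addr0 -opprD tt opprK [s + (s + t)]addrA ss.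
rewrite [t + (- s + t)]addrCA tt [- s + (- s - t)]addrA -opprD ss opprK.
by rewrite [t + _]addrCA subrr addr0.
Qed.

Lemma helix_sub : {subset helix s t <= S}.
Proof.
move=> x; rewrite !inE => x_in.
by case/or4P: x_in => [||| /or4P[||| /orP[]]] /eqP->.
Qed.

Lemma snake_sub : {subset snake s t <= S}.
Proof.
move=> x; rewrite !inE => x_in.
by case/or4P: x_in => [||| /or4P[||| /orP[]]] /eqP->; rewrite ?oppS.
Qed.

Lemma ham_word_plane r R : is_coset_path S s plane r -> is_cap S s r R ->
  ham_word S (helix s t ++ R) /\ ham_word S (snake s t ++ R).
Proof.
move=> r_path R_cap; split; apply: (ham_word_cap _ r_path R_cap);
  rewrite ?card_plane //.
- exact: mem_plane_s.
- exact: helix_sub.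
- exact: word_sum_helix.
- exact: helix_cover.
- exact: mem_plane_s.
- exact: snake_sub.
- exact: word_sum_snake.
- exact: snake_cover.
Qed.

Hypotheses (st : s + t \notin S) (t_s : t - s \notin S).

(** Every 3-window of the helix word has sum [t - s], so its count is 0, while the snake contains
    [s, t, - s] with sum [t]. *)
Lemma snake_helix_cycle :
  ~ (ham_word S (helix s t ++ [:: s]) /\ ham_word S (snake s t ++ [:: s])).
Proof.
case=> h_ham w_ham; have := nwin_inv 3 h_ham w_ham; rewrite !nwin3E /=.
have ss := order3_double s3; have tt := order3_double t3.
have -> : s + t + s = t - s by rewrite addrAC ss addrC.
have -> : t + s + s = t - s by rewrite -addrA ss.
have -> : s + s + t = t - s by rewrite ss addrC.
have -> : s + t - s = t by rewrite addrAC subrr add0r.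
by rewrite (negbTE t_s) tS.
Qed.

(** The 2 counts the windows [s, t, - s] and [- s, t, s] of the snake; the other windows inside the
    plane sum to [t - s] or to [s + t] up to sign, outside [S]. *)
Lemma snake_helix_windows u R :
    ham_word S (helix s t ++ [:: u, - s & R]) ->
    ham_word S (snake s t ++ [:: u, - s & R]) ->
  (ind (u + s + t) + ind (u + t - s) = 2 + ind (u + t) + ind (u - s - t))%N.
Proof.
move=> h_ham w_ham; have := nwin_inv 3 h_ham w_ham; rewrite !nwin3E /=.
have ss := order3_double s3; have tt := order3_double t3.
have -> : s + t + s = t - s by rewrite addrAC ss addrC.
have -> : t + s + s = t - s by rewrite -addrA ss.
have -> : s + s + t = t - s by rewrite ss addrC.
have -> : s + t - s = t by rewrite addrAC subrr add0r.
have -> : t - s + t = - (s + t) by rewrite addrAC tt opprD addrC.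
have -> : - s + t + s = t by rewrite addrAC addNr add0r.
have -> : s + s - t = - (s + t) by rewrite ss opprD.
have -> : s - t - t = s + t by rewrite -addrA -opprD tt opprK.
have -> : - t - t + u = u + t by rewrite -opprD tt opprK addrC.
have -> : s + t + u = u + s + t by rewrite addrC addrA.
have -> : t + u - s = u + t - s by rewrite [t + u]addrC.
have -> : - t + u - s = u - s - t by rewrite [- t + u]addrC addrAC.
by rewrite !oppS (negbTE t_s) (negbTE st) tS /=; lia_bool.
Qed.

Lemma plane_extension u : u \in S -> u \notin plane ->
  exists R, ham_word S (helix s t ++ [:: u, - s & R]) /\
            ham_word S (snake s t ++ [:: u, - s & R]).
Proof.
move=> uS uP.
have [r r_path] := coset_path_exists S_gen n_odd plane_path uS uP.
set ts' := [:: t; t] ++ _ in r_path.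
(* With [s] of order 3 and [k = 0], one step [- s] precedes the inner cap, so the cap begins with
   [u, - s]. *)
have R_cap : is_cap S s (u :: ts') (cap_level s 0 u (cap (- s) ts')).
  apply: is_cap_level => //; first by rewrite s3.
  have [rS _ _] := r_path; apply: is_cap_cap; rewrite ?oppS ?order_opp ?s3 //.
  by move=> x x_in; have /rS/setDP[] : x \in u :: ts' by rewrite in_cons x_in orbT.
have := ham_word_plane r_path R_cap; rewrite /cap_level s3 /=.
by move=> hams; eexists; apply: hams.
Qed.

End Plane.

Lemma order3_sum s t :
    s \in S -> t \in S -> t \notin <[s]>%g -> #[s]%g = 3%N -> #[t]%g = 3%N ->
  s + t \in S.
Proof.
move=> sS tS ts s3 t3; apply/contraT => st.
have Dst := zigzag_windows2_order3 S_gen n_odd oppS S_0 nwin_inv sS tS ts s3.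
have t_s : t - s \notin S by rewrite -Dst.
have [sub|/subsetPn[u uS uP]] := boolP (S \subset (<[s]> <*> <[t]>)%g).
  have planeT : (<[s]> <*> <[t]>)%G = [set: Gamma]%G by apply: (gen_full S_gen).
  have := ham_word_plane sS tS ts s3 t3 (coset_path_nil S s planeT) (is_cap_nil sS).
  by move/(snake_helix_cycle tS s3 t3 t_s).
have [R [h_ham w_ham]] := plane_extension sS tS ts s3 t3 uS uP.
have eq1 := snake_helix_windows tS s3 t3 st t_s h_ham w_ham.
have uP' : u \notin (<[s]> <*> <[- t]>)%g by rewrite cycle_opp.
have NtS : - t \in S by rewrite oppS.
have Nts : - t \notin <[s]>%g by rewrite mem_groupN.
have Nt3 : #[- t]%g = 3%N by rewrite order_opp.
have [R' [h_ham' w_ham']] := plane_extension sS NtS Nts s3 Nt3 uS uP'.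
have sNt : s - t \notin S by rewrite (oppSB oppS).
have Nt_s : - t - s \notin S by rewrite (oppSD oppS) addrC.
(* The relation for [t] forces [u - s - t] out of [S], the one for [- t] forces it into [S]. *)
have := snake_helix_windows NtS s3 Nt3 sNt Nt_s h_ham' w_ham'.
rewrite [u - t - s]addrAC; move: eq1; lia_bool.
Qed.

Lemma sum_closed_order3 : (forall s, s \in S -> #[s]%g = 3%N) -> sum_closed S.
Proof.
move=> S3 a b aS bS ab; have [|ba] := boolP (b \in <[a]>%g); last first.
  by apply: order3_sum; rewrite ?S3.
case/mem_cycle_mulrn=> j; rewrite S3 //; case: j => [|[|[|//]]] _ b_def.
- by rewrite b_def mulr0n (negbTE S_0) in bS.
- by rewrite b_def mulr1n order3_double ?oppS // S3.
- by rewrite b_def -mulrS -{1}(S3 a aS) mulrn_order eqxx in ab.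
Qed.

End Order3.

(** * Transitivity of complete graphs and of graphs of degree at most 2 *)

Section Graphs.
Variables (T : finType) (e : rel T).

Lemma cycle_edges_map (f : {perm T}) (c : seq T) :
  uniq c -> cycle_edges (map f c) = map_edges f (cycle_edges c).
Proof.
move=> c_uniq; apply/setP=> A; apply/imsetP/imsetP => [[y]|[B]].
  case/mapP=> x xc -> ->; exists [set x; next c x]; first exact: imset_f.
  by rewrite next_map ?imsetU1 ?imset_set1 //; apply: perm_inj.
case/imsetP=> x xc -> ->; exists (f x); first exact: map_f.
by rewrite next_map ?imsetU1 ?imset_set1 //; apply: perm_inj.
Qed.

(** Every permutation is an automorphism, so the vertices of one cycle can be sent in order to those
    of the other. *)
Lemma complete_transitive (H1 H2 : {set {set T}}) :
    (forall x y, e x y = (x != y)) ->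
    hamiltonian_cycle e H1 -> hamiltonian_cycle e H2 ->
  exists2 f : {perm T}, graph_aut e f & map_edges f H1 = H2.
Proof.
move=> eE [c1 [c1_size /andP[_ U1] in1 ->]] [c2 [_ /andP[_ U2] in2 ->]].
have size12 : size c1 = size c2 by apply/perm_size/uniq_perm => // x; rewrite in1 in2.
have f_inj : injective (fun x => nth x c2 (index x c1)).
  move=> x y; rewrite (set_nth_default x y) -?size12 ?index_mem //.
  move/eqP; rewrite nth_uniq -?size12 ?index_mem // => /eqP/(congr1 (nth x c1)).
  by rewrite !nth_index.
exists (perm f_inj); first by move=> x y; rewrite !eE (inj_eq perm_inj).
rewrite -cycle_edges_map //; congr cycle_edges.
case: c1 c1_size in1 U1 size12 f_inj => // x0 c1 _ in1 U1 size12 f_inj.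
apply: (@eq_from_nth _ x0); rewrite size_map // => i lt_i.
rewrite (nth_map x0) // permE index_uniq //; apply: set_nth_default.
by rewrite -size12.
Qed.

(** The cycle already gives [x] two distinct neighbours, [prev c x] and [next c x]; an edge off the
    cycle would add a third. *)
Lemma ham_cycle_edges_deg2 (H : {set {set T}}) (A : {set T}) :
    symmetric e -> (forall x, #|[set y | e x y]| <= 2)%N -> hamiltonian_cycle e H ->
  A \in H <-> exists x y, e x y /\ A = [set x; y].
Proof.
move=> e_sym deg2 [c [c_size /andP[e_c c_uniq] in_c ->]]; split.
  case/imsetP=> x xc ->; exists x, (next c x); split=> //; exact: next_cycle.
case=> x [y [xy ->]].
have prev_neq_next : prev c x != next c x.
  have /negP := next_next_neq c_uniq c_size (in_c (prev c x)).
  by rewrite (next_prev c_uniq) eq_sym; move/negP.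
have := deg2 x; rewrite leqNgt; apply: contraNT => xyH.
apply: leq_trans (_ : #|y |: [set prev c x; next c x]| <= _)%N; last first.
  apply/subset_leq_card/subsetP => z; rewrite !inE => /or3P[] /eqP-> //.
    by rewrite e_sym prev_cycle.
  exact: next_cycle.
rewrite cardsU1 cards2 prev_neq_next !inE negb_or.
have -> : y != next c x by apply: contraNneq xyH => ->; apply: imset_f.
have -> // : y != prev c x.
apply: contraNneq xyH => ->; rewrite setUC -{2}(next_prev c_uniq x).
exact: imset_f.
Qed.

Lemma degree2_transitive (H1 H2 : {set {set T}}) :
    symmetric e -> (forall x, #|[set y | e x y]| <= 2)%N ->
    hamiltonian_cycle e H1 -> hamiltonian_cycle e H2 ->
  exists2 f : {perm T}, graph_aut e f & map_edges f H1 = H2.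
Proof.
move=> e_sym deg2 ham1 ham2; exists 1%g => [x y|]; first by rewrite !perm1.
have -> : map_edges 1 H1 = H1.
  rewrite /map_edges -[RHS]imset_id; apply: eq_imset => A.
  by rewrite -[RHS]imset_id; apply: eq_imset => x; rewrite perm1.
have edges1 A := ham_cycle_edges_deg2 A e_sym deg2 ham1.
have edges2 A := ham_cycle_edges_deg2 A e_sym deg2 ham2.
by apply/setP=> A; apply/idP/idP => [/edges1/edges2|/edges2/edges1].
Qed.

Lemma iso_cycle_graph_deg2 n (x : T) :
  graph_iso e (@cycle_graph n) -> (#|[set y | e x y]| <= 2)%N.
Proof.
case=> f f_bij f_e; case: (f_bij) => g fK gK.
apply: leq_trans (_ : #|[set g (ordS (f x)); g (ord_pred (f x))]| <= _)%N.
  apply/subset_leq_card/subsetP => y; rewrite !inE -f_e => /orP[]/eqP fy.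
    by rewrite -fy fK eqxx.
  by rewrite fy ordSK fK eqxx orbT.
by rewrite cards2; case: (_ != _).
Qed.

Lemma complete_iso : (forall x y, e x y = (x != y)) ->
  graph_iso e (@complete_graph #|T|).
Proof.
move=> eE; exists enum_rank; first exact: enum_rank_bij.
by move=> x y; rewrite eE /complete_graph (inj_eq enum_rank_inj).
Qed.

End Graphs.

(** * Translation between connection sets and graph isomorphisms *)

Section Classification.
Local Open Scope ring_scope.
Variables (Gamma : finZmodType) (S : {set Gamma}).
Hypothesis n_odd : odd #|Gamma|.
Hypothesis n_ge3 : (3 <= #|Gamma|)%N.
Hypothesis S_gen : <<S>>%g = [set: Gamma].
Hypothesis S_opp : S = [set - x | x in S].
Hypothesis S_0 : 0 \notin S.

Lemma opp_mem x : (- x \in S) = (x \in S).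
Proof.
by rewrite {1}S_opp -{1}[x]opprK mem_imset ?opprK //; apply: oppr_inj.
Qed.

Lemma connection_set_nonempty : exists s, s \in S.
Proof.
have [S0|[s sS]] := set_0Vmem S; last by exists s.
have := congr1 (fun A : {set Gamma} => #|A|) S_gen.
by rewrite S0 gen0 cards1 cardsT => n1; move: n_ge3; rewrite -n1.
Qed.

Lemma hamiltonian_cycle_exists : exists H, hamiltonian_cycle (Cay S) H.
Proof.
have [s sS] := connection_set_nonempty.
have [r [r_path r_cap]] := ham_word_base S_gen n_odd opp_mem S_0 sS.
have w_ham := ham_word_run n_odd S_0 sS r_path r_cap.
by eexists; apply: ham_word_cycle w_ham n_ge3 opp_mem.
Qed.

Lemma iso_transitive :
    graph_iso (Cay S) (@complete_graph #|Gamma|) \/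
    graph_iso (Cay S) (@cycle_graph #|Gamma|) ->
  hamiltonian_transitive (Cay S).
Proof.
move=> iso; split; first exact: hamiltonian_cycle_exists.
move=> H1 H2 ham1 ham2; case: iso => [[f /bij_inj f_inj f_e] | iso].
  apply: complete_transitive ham1 ham2 => x y.
  by rewrite -f_e /complete_graph (inj_eq f_inj).
apply: degree2_transitive ham1 ham2; first exact: Cay_sym.
by move=> x; apply: iso_cycle_graph_deg2 iso.
Qed.

(** Adding 0 turns [S] into a subgroup, which contains the generators and hence is all of
    [Gamma]. *)
Lemma sum_closed_complete :
  sum_closed S -> graph_iso (Cay S) (@complete_graph #|Gamma|).
Proof.
move=> closed; apply: complete_iso => x y.
have S0_group : group_set (0 |: S).
  apply/group_setP; split=> [|a b]; first exact: setU11.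
  rewrite zmodMgE !in_setU1 => /orP[/eqP->|aS] /orP[/eqP->|bS];
    rewrite ?addr0 ?add0r ?eqxx ?aS ?bS ?orbT //.
  by have [//|ab] := eqVneq (a + b) 0; rewrite closed.
have : x - y \in Group S0_group.
  have /(gen_full S_gen) -> : S \subset Group S0_group by apply: subsetUr.
  exact: in_setT.
rewrite in_setU1 subr_eq0 /Cay; case: eqP => [->|] //=.
by rewrite subrr (negbTE S_0).
Qed.

(** The isomorphism inverts [i |-> g *+ i], under which the successor modulo the order becomes
    addition of [g]. *)
Lemma sign_pair_cycle g :
    g \in S -> <[g]>%g = [set: Gamma] ->
    (forall x, x \in S -> (x == g) || (x == - g)) ->
  graph_iso (Cay S) (@cycle_graph #|Gamma|).
Proof.
move=> gS g_gen SE.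
have g_card : #[g]%g = #|Gamma| by rewrite /order g_gen cardsT.
pose mul_g (i : 'I_#|Gamma|) := g *+ i.
have mul_g_bij : bijective mul_g.
  apply: inj_card_bij; last by rewrite card_ord.
  move=> i j /eqP; rewrite /mul_g -!zmodXgE eq_expg_mod_order g_card.
  by rewrite !modn_small // => /eqP/val_inj.
have mul_gS i : mul_g (ordS i) = g + mul_g i.
  have mod_card k : g *+ (k %% #|Gamma|) = g *+ k.
    by rewrite -g_card -!zmodXgE expg_mod_order.
  by rewrite /mul_g /= mod_card mulrS.
case: (mul_g_bij) => f fK gK; exists f; first by exists mul_g.
have step x y : (f y == ordS (f x)) = (y - x == g).
  by rewrite -(inj_eq (bij_inj mul_g_bij)) mul_gS !gK subr_eq.
move=> x y; rewrite /cycle_graph !step /Cay.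
have -> : (y - x == g) = (x - y == - g) by rewrite -[x - y]opprB eqr_opp.
rewrite orbC; apply/idP/idP => [/orP[]/eqP->|/SE //]; by rewrite ?opp_mem.
Qed.

Lemma transitive_iso :
    hamiltonian_transitive (Cay S) ->
  graph_iso (Cay S) (@complete_graph #|Gamma|) \/
  graph_iso (Cay S) (@cycle_graph #|Gamma|).
Proof.
move=> trans.
have nwin_inv k w1 w2 : ham_word S w1 -> ham_word S w2 -> nwin S k w1 = nwin S k w2.
  exact: nwin_invariant.
have [S3|] := boolP [forall s in S, #[s]%g == 3%N].
  left; apply: sum_closed_complete.
  apply: (sum_closed_order3 S_gen n_odd opp_mem S_0 nwin_inv) => x xS.
  by apply/eqP/(forall_inP S3).
rewrite negb_forall_in => /exists_inP[a aS a_neq3].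
have a_gt4 : (4 < #[a]%g)%N.
  have := order_gt2 n_odd S_0 aS; have := order_neq4 n_odd a.
  by case: #[a]%g a_neq3 => [|[|[|[|[]]]]].
have [closed|sum_free] := sum_closed_or_free S_gen n_odd opp_mem S_0 nwin_inv aS a_gt4.
  by left; apply: sum_closed_complete.
have [g gS g_gen] := sum_free_generator S_gen n_odd opp_mem S_0 nwin_inv sum_free aS.
right; apply: (sign_pair_cycle gS g_gen) => x xS.
exact: (sum_free_sign n_odd opp_mem S_0 nwin_inv sum_free gS g_gen xS).
Qed.

End Classification.

Theorem theorem2 (Gamma : finZmodType) (n : nat) (S : {set Gamma})
    (card_Gamma : #|Gamma| = n) (n_odd : odd n) (n_ge3 : 3 <= n)
    (S_gen : <<S>>%g = [set: Gamma])
    (S_opp : S = [set (- x)%R | x in S]) (S_0 : 0%R \notin S) :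
  hamiltonian_transitive (Cay S) <->
  graph_iso (Cay S) (@complete_graph n) \/ graph_iso (Cay S) (@cycle_graph n).
Proof.
by subst n; split; [apply: transitive_iso | apply: iso_transitive].
Qed.
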